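(* Let $p$ be a prime. For $i=1,2$ let $\mathcal{F}_i$ be a saturated fusion system over the finite $p$-group $S_i$, and let $\phi\colon S_1\to S_2$ be a fusion preserving homomorphism. If the induced map in cohomology $H^i(\mathcal{F}_2;\mathbb{F}_p)\to H^i(\mathcal{F}_1;\mathbb{F}_p)$ is an isomorphism for $i=1$ and a monomorphism for $i=2$, then $$S_1/O^p_{\mathcal{F}_1}(S_1)\cong S_2/O^p_{\mathcal{F}_2}(S_2).$$
   Context: Fusion systems over finite $p$-groups are in the sense of Puig and Broto–Levi–Oliver: objects are the subgroups of $S$, morphisms are certain injective homomorphisms including those induced by conjugation in $S$, subject to the saturation axioms. A group homomorphism $\phi\colon S_1\to S_2$ is fusion preserving (with respect to $\mathcal{F}_1,\mathcal{F}_2$) if for each $P\le S_1$ and $\varphi\in \operatorname{Hom}_{\mathcal{F}_1}(P,S_1)$ there exists $\hat\varphi\in\operatorname{Hom}_{\mathcal{F}_2}(\phi(P),S_2)$ with $\phi\circ\varphi=\hat\varphi\circ\phi|_P$. For a fusion system $\mathcal{F}$ over $S$, $H^*(\mathcal{F};\mathbb{F}_p)=\{z\in H^*(S;\mathbb{F}_p)\mid \operatorname{res}(z)=\varphi^*(z)\text{ for each }P\le S,\ \varphi\in\operatorname{Hom}_{\mathcal{F}}(P,S)\}$, where $\operatorname{res}$ is restriction to $H^*(P;\mathbb{F}_p)$. If $\phi$ is fusion preserving then $\phi^*\colon H^*(S_2;\mathbb{F}_p)\to H^*(S_1;\mathbb{F}_p)$ restricts to the induced map $H^*(\mathcal{F}_2;\mathbb{F}_p)\to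 H^*(\mathcal{F}_1;\mathbb{F}_p)$. The hyperfocal subgroup of $\mathcal{F}$ is $O^p_{\mathcal{F}}(S)=\langle [P,O^p(\operatorname{Aut}_{\mathcal{F}}(P))]\mid P\le S\rangle$, where $O^p(\operatorname{Aut}_{\mathcal{F}}(P))$ is the smallest normal subgroup of $p$-power index in $\operatorname{Aut}_{\mathcal{F}}(P)$ and $[P,A]=\langle x^{-1}\alpha(x)\mid x\in P,\alpha\in A\rangle$. *)

(* Defs.v *)
From HB Require Import structures.
From mathcomp Require Import all_boot all_fingroup all_algebra all_solvable.

Set Implicit Arguments.
Unset Strict Implicit.
Unset Printing Implicit Defensive.

Import GRing.Theory.
Local Open Scope group_scope.

(** * Fusion systems *)

(* [fs_hom P Q] is the set Hom_F(P, Q) for P, Q <= S.  A morphism P -> Q is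
   represented by a function on the ambient group, of which only the values on P
   matter ([fs_ext]).  Conjugation acts on the right: x ^ g = g^-1 * x * g. *)
Record fusion_system (gT : finGroupType) (S : {group gT}) := FusionSystem {
  fs_hom : {group gT} -> {group gT} -> pred (gT -> gT);
  fs_ext : forall (P Q : {group gT}) (f g : gT -> gT),
    {in P, f =1 g} -> fs_hom P Q f -> fs_hom P Q g;
  fs_obj : forall (P Q : {group gT}) (f : gT -> gT),
    fs_hom P Q f -> P \subset S /\ Q \subset S;
  fs_inj : forall (P Q : {group gT}) (f : gT -> gT), fs_hom P Q f ->
    [/\ {in P &, {morph f : x y / x * y}}, {in P &, injective f}
      & f @: P \subset Q];
  fs_conj : forall (P Q : {group gT}) (g : gT),
    P \subset S -> Q \subset S -> g \in S -> P :^ g \subset Q ->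
    fs_hom P Q (fun x => x ^ g);
  fs_comp : forall (P Q R : {group gT}) (f g : gT -> gT),
    fs_hom P Q f -> fs_hom Q R g -> fs_hom P R (g \o f);
  (* every morphism is an isomorphism of the category followed by an inclusion *)
  fs_factor : forall (P Q : {group gT}) (f : gT -> gT), fs_hom P Q f ->
    exists2 R : {group gT}, R \subset Q &
      fs_hom P R f /\
      exists2 g : gT -> gT, fs_hom R P g & {in P, cancel f g} /\ {in R, cancel g f}
}.

Section Saturation.

Variables (gT : finGroupType) (S : {group gT}) (F : fusion_system S).
Implicit Types P Q : {group gT}.

Definition Aut_fs P : {set {perm gT}} := [set a in Aut P | fs_hom F P P a].

Definition Aut_conj P : {set {perm gT}} := conj_aut P @* 'N_S(P).

Definition fully_centralized P : Prop :=
  forall f, fs_hom F P S f -> #|'C_S(f @: P)| <= #|'C_S(P)|.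

Definition fully_normalized P : Prop :=
  forall f, fs_hom F P S f -> #|'N_S(f @: P)| <= #|'N_S(P)|.

(* N_f = {g in N_S(P) | f c_g f^-1 \in Aut_S(f(P))} *)
Definition extender P (f : gT -> gT) : {set gT} :=
  [set g in 'N_S(P) | [exists h in 'N_S(f @: P),
                         [forall x in P, f (x ^ g) == f x ^ h]]].

Definition saturated (p : nat) : Prop :=
  (forall P, P \subset S -> fully_normalized P ->
     fully_centralized P /\ p.-Sylow(Aut_fs P) (Aut_conj P)) /\
  (forall P Q f, fs_hom F P S f -> Q :=: f @: P -> fully_centralized Q ->
     exists N : {group gT}, N :=: extender P f /\
       exists2 g : gT -> gT, fs_hom F N S g & {in P, g =1 f}).

End Saturation.

Definition fusion_preserving (gT1 gT2 : finGroupType)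
    (S1 : {group gT1}) (S2 : {group gT2})
    (F1 : fusion_system S1) (F2 : fusion_system S2)
    (phi : {morphism S1 >-> gT2}) : Prop :=
  forall (P : {group gT1}) (f : gT1 -> gT1), fs_hom F1 P S1 f ->
    exists2 f' : gT2 -> gT2, fs_hom F2 (phi @* P)%G S2 f' &
      {in P, forall x, phi (f x) = f' (phi x)}.

(** * The hyperfocal subgroup *)

(* O^p(A): the intersection of all normal subgroups of p-power index, which is
   itself one of them *)
Definition presidual (p : nat) (rT : finGroupType) (A : {set rT}) : {set rT} :=
  \bigcap_(N : {group rT} | (N <| A) && p.-nat #|A : N|) N.

Definition commg_aut (gT : finGroupType) (P : {set gT}) (A : {set {perm gT}}) :
  {set gT} := <<[set x^-1 * (a : {perm gT}) x | x in P, a in A]>>.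

(* This is a normal subgroup of S. *)
Definition hyperfocal (p : nat) (gT : finGroupType) (S : {group gT})
    (F : fusion_system S) : {set gT} :=
  <<\bigcup_(P : {group gT} | P \subset S)
      commg_aut P (presidual p (Aut_fs F P))>>.

(** * Cohomology with trivial coefficients in F_p *)

(* inhomogeneous n-cochains of the whole group aT *)
Definition cochain (p : nat) (aT : finGroupType) (n : nat) :=
  {ffun aT ^ n -> 'F_p}.

HB.instance Definition _ p aT n := GRing.Zmodule.on (cochain p aT n).
HB.instance Definition _ p aT n := Finite.on (cochain p aT n).
HB.instance Definition _ p aT n := [finGroupMixin of cochain p aT n for +%R].

Lemma cochain_abelian p aT n (A : {set cochain p aT n}) : abelian A.
Proof. by apply/centsP=> x _ y _; apply: addrC. Qed.

Section Cohomology.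

Variables (p : nat) (aT : finGroupType).

(* For g = (g_1, ..., g_(n+1)): face 0 g = (g_2, ..., g_(n+1)),
   face i g = (g_1, ..., g_i * g_(i+1), ..., g_(n+1)) if 0 < i < n+1,
   face (n+1) g = (g_1, ..., g_n). *)
Definition face (n : nat) (i : 'I_n.+2) (g : aT ^ n.+1) : aT ^ n :=
  [ffun j : 'I_n =>
     let gj := g (widen_ord (leqnSn n) j) in
     let gj1 := g (lift ord0 j) in
     if j.+1 < i then gj else if j.+1 == i then gj * gj1 else gj1].

Definition cobound (n : nat) (c : cochain p aT n) : cochain p aT n.+1 :=
  [ffun g => (\sum_(i < n.+2) (-1) ^+ i * c (face i g))%R].

Lemma coboundM n : {morph @cobound n : c d / c * d}.
Proof.
move=> c d; apply/ffunP=> g; rewrite !ffunE -big_split /=.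
by apply: eq_bigr => i _; rewrite ffunE mulrDr.
Qed.

Canonical cobound_morphism n :=
  @Morphism _ _ [set: cochain p aT n] (@cobound n)
    (fun c d _ _ => coboundM c d).

Definition cocycles n : {group cochain p aT n} :=
  'ker (cobound_morphism n).

Definition coboundaries n : {group cochain p aT n} :=
  match n with
  | 0 => 1%G
  | m.+1 => (cobound_morphism m @* [set: cochain p aT m])%G
  end.

Definition cohclass n := coset_of (coboundaries n).

Definition cohomology n : {set cohclass n} := cocycles n / coboundaries n.

End Cohomology.

Arguments cohclass : clear implicits.
Arguments cohomology : clear implicits.
Arguments cocycles : clear implicits.
Arguments coboundaries : clear implicits.

Definition pullback p (aT bT : finGroupType) (f : aT -> bT) n
    (c : cochain p bT n) : cochain p aT n :=
  [ffun g : aT ^ n => c [ffun i => f (g i)]].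

(* The map f^* : H^n(bT) -> H^n(aT) induced by a homomorphism f, computed on a
   representative of the class; independence of the choice is [cohmapE]. *)
Definition cohmap p (aT bT : finGroupType) (f : aT -> bT) n
    (z : cohclass p bT n) : cohclass p aT n :=
  coset _ (pullback f (repr z)).

Section Functoriality.

Variables (p : nat) (aT bT : finGroupType) (f : aT -> bT).

Lemma pullbackM n :
  {morph @pullback p aT bT f n : c d / c * d}.
Proof. by move=> c d; apply/ffunP=> g; rewrite !ffunE. Qed.

Hypothesis fM : {morph f : x y / x * y}.

Lemma pullback_cobound n (c : cochain p bT n) :
  pullback f (cobound c) = cobound (pullback f c).
Proof.
apply/ffunP=> g; rewrite !ffunE; apply: eq_bigr => i _; rewrite !ffunE.
congr (_ * c _)%R; apply/ffunP=> j; rewrite !ffunE /=.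
by case: ifP => // _; case: ifP.
Qed.

Lemma pullback_coboundaries n (c : cochain p bT n) :
  c \in coboundaries p bT n -> pullback f c \in coboundaries p aT n.
Proof.
case: n c => [|n] c /=.
  by move/set1P->; rewrite inE; apply/eqP/ffunP=> g; rewrite !ffunE.
case/morphimP=> d _ _ ->; rewrite [X in X \in _]pullback_cobound.
by rewrite mem_morphim ?inE.
Qed.

Lemma cohmapE n (c : cochain p bT n) :
  cohmap f (coset (coboundaries p bT n) c)
    = coset (coboundaries p aT n) (pullback f c).
Proof.
have nB T (x : cochain p T n) : x \in 'N(coboundaries p T n).
  by rewrite (subsetP (sub_abelian_norm (cochain_abelian setT) _)) ?subsetT ?inE.
rewrite /cohmap; have := mem_repr_coset (coset (coboundaries p bT n) c).
rewrite val_coset ?nB // => /rcosetP[b Bb ->].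
by rewrite pullbackM coset_kerl ?pullback_coboundaries.
Qed.

Lemma cohmapM n : {morph @cohmap p aT bT f n : y z / y * z}.
Proof.
have nB (x : cochain p bT n) : x \in 'N(coboundaries p bT n).
  by rewrite (subsetP (sub_abelian_norm (cochain_abelian setT) _)) ?subsetT ?inE.
have nA (x : cochain p aT n) : x \in 'N(coboundaries p aT n).
  by rewrite (subsetP (sub_abelian_norm (cochain_abelian setT) _)) ?subsetT ?inE.
move=> y z; rewrite -[y]coset_reprK -[z]coset_reprK -morphM ?nB // !cohmapE.
by rewrite pullbackM morphM ?nA.
Qed.

End Functoriality.

(** * Stable classes *)

(* The map H^n(Q) -> H^n(P) induced by a homomorphism f : P -> Q of subgroups
   ([subg Q] corestricts to the type of elements of Q). *)
Definition subg_cohmap p (gT1 gT2 : finGroupType)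
    (P : {group gT1}) (Q : {group gT2}) (f : gT1 -> gT2) n :
    cohclass p (subg_of Q) n -> cohclass p (subg_of P) n :=
  @cohmap p (subg_of P) (subg_of Q) (fun x => subg Q (f (sgval x))) n.

Arguments subg_cohmap p {gT1 gT2} P Q f n _.

(* By [fs_ext], quantifying over finite functions loses nothing. *)
Definition fs_cohomology p (gT : finGroupType) (S : {group gT})
    (F : fusion_system S) n : {set cohclass p (subg_of S) n} :=
  [set z in cohomology p (subg_of S) n |
    [forall P : {group gT}, forall f : {ffun gT -> gT},
      fs_hom F P S f ==>
        (subg_cohmap p P S id n z == subg_cohmap p P S f n z)]].

Arguments fs_cohomology p {gT S} F n.

(* Main.v *)
(* Write [h] for the hyperfocal subgroup.  By Alperin's fusion theorem every
   morphism of [F] agrees with conjugation by an element of [S] modulo [h], so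
   inflation maps H^n(S/h) into H^n(F), and H^1(S/h) = H^1(F).  The crux is that
   H^2(S/h) -> H^2(S) is injective, that is, that every S-invariant homomorphism
   gam : h -> F_p extends to S.
   To see this, transfer gam along a virtual (S,S)-biset that is F-stable and of
   degree N prime to p: the result has the form U + N gam on h, where U is a
   homomorphism on all of S, and it is F-stable.  An F-stable homomorphism on h
   vanishes, since h is generated by the elements x^-1 a(x) with a a
   p'-automorphism; hence -U/N extends gam.
   Given this, Stallings' argument applies to S1/h1 -> S2/h2: it is onto since it
   is injective on H^1.  If its kernel K/h1 were nontrivial, a nonzero
   S1-invariant homomorphism K/h1 -> F_p would transgress to a class of H^2(S2/h2)
   dying in H^2(F1), hence in H^2(F2), hence zero; so it would extend to S1, and by
   surjectivity on H^1 it would come from S2/h2 and vanish on K. *)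

Require Import Defs.
From mathcomp Require Import all_boot all_fingroup all_algebra all_solvable.
From mathcomp Require Import ring.

Set Implicit Arguments.
Unset Strict Implicit.
Unset Printing Implicit Defensive.

Import GRing.Theory Num.Theory.
Local Open Scope group_scope.

(** * Morphisms of fusion systems *)

(** Transferring [gam] meets a difficulty: [gam] is additive on h only, while transfer from P to S
    wants a homomorphism on all of P. The remedy is to work with a function [gam] on S whose
    coboundary depends only on classes mod h. A morphism f on P agrees mod h with conjugation by
    some s, so [gam (f x) - gam (x ^ s)] is additive on P and can be transferred; the terms
    [gam (x ^ s)] produce the multiple N gam. Stability of the remaining terms is the other
    obstacle. The biset is controlled through its marks, that is, numbers of fixed points, whereas
    the transfer at t sums over orbits of t. The orbits are recovered from the fixed points of
    powers of t by recursion over divisors, which involves dividing by orbit lengths, and these are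
    powers of p. Hence the orbits are counted in the rationals, sorted by length and by value of
    [gam], and reduced mod p only at the end. Negative multiplicities do no harm to such sums, so a
    virtual biset suffices. It is built downwards on the order of subgroups, by congruences between
    marks. *)

Section FusionBasics.

Variables (gT : finGroupType) (S : {group gT}) (F : fusion_system S).
Implicit Types P Q R : {group gT}.

Lemma fs_incl P Q : P \subset Q -> Q \subset S -> fs_hom F P Q id.
Proof.
move=> sPQ sQS; apply: (@fs_ext _ _ F P Q (fun x => x ^ 1)) => [x _|].
  by rewrite conjg1.
by apply: fs_conj; rewrite ?group1 ?conjsg1 // (subset_trans sPQ).
Qed.

Lemma fs_res P Q R f : fs_hom F P Q f -> R \subset P -> fs_hom F R Q f.
Proof.
move=> hf sRP; have [sPS _] := fs_obj hf.
exact: (fs_comp (fs_incl sRP sPS) hf).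
Qed.

Lemma fs_hom_ffun P Q f : fs_hom F P Q [ffun x => f x] = fs_hom F P Q f.
Proof. by apply/idP/idP; apply: fs_ext => x _; rewrite ffunE. Qed.

Lemma fs_onto P Q f : fs_hom F P Q f ->
  exists2 R : {group gT}, R :=: f @: P & fs_hom F P R f.
Proof.
case/fs_factor=> R _ [hf [g hg [fK gK]]]; exists R => //.
have [_ _ sfR] := fs_inj hf; have [_ _ sgP] := fs_inj hg.
apply/eqP; rewrite eqEsubset sfR andbT; apply/subsetP=> y Ry.
by rewrite -(gK y Ry) imset_f // (subsetP sgP) ?imset_f.
Qed.

Lemma fs_corestr P Q R f :
  fs_hom F P Q f -> f @: P \subset R -> R \subset S -> fs_hom F P R f.
Proof.
case/fs_onto=> Q' defQ' hf sfR sRS.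
have sQ'R: Q' \subset R by rewrite defQ'.
exact: (fs_comp hf (fs_incl sQ'R sRS)).
Qed.

Lemma fs_inverse P R f : fs_hom F P R f -> R :=: f @: P ->
  exists2 g, fs_hom F R P g & {in P, cancel f g} /\ {in R, cancel g f}.
Proof.
case/fs_factor=> R' _ [hf [g hg [fK gK]]] defR.
have [_ _ sfR] := fs_inj hf; have [_ _ sgP] := fs_inj hg.
have RR': R :=: R'.
  apply/eqP; rewrite defR eqEsubset sfR /=; apply/subsetP=> y Ry.
  by rewrite -(gK y Ry) imset_f // (subsetP sgP) ?imset_f.
have{} RR' : R = R' by apply: val_inj.
by rewrite RR'; exists g.
Qed.

Lemma fs_morphM P Q f : fs_hom F P Q f -> {in P &, {morph f : x y / x * y}}.
Proof. by case/fs_inj. Qed.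

Lemma fs_injective P Q f : fs_hom F P Q f -> {in P &, injective f}.
Proof. by case/fs_inj. Qed.

Lemma fs_mem P Q f x : fs_hom F P Q f -> x \in P -> f x \in Q.
Proof. by case/fs_inj=> _ _ /subsetP sfQ Px; rewrite sfQ ?imset_f. Qed.

Lemma fs_morph1 P Q f : fs_hom F P Q f -> f 1 = 1.
Proof.
move=> hf; apply: (mulgI (f 1)); rewrite mulg1.
by rewrite -(fs_morphM hf) ?group1 ?mulg1.
Qed.

Lemma fs_morphV P Q f x : fs_hom F P Q f -> x \in P -> f x^-1 = (f x)^-1.
Proof.
move=> hf Px; apply: (mulgI (f x)); rewrite mulgV.
by rewrite -(fs_morphM hf) ?groupV // mulgV (fs_morph1 hf).
Qed.

Lemma fs_morphX P Q f x n : fs_hom F P Q f -> x \in P -> f (x ^+ n) = f x ^+ n.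
Proof.
move=> hf Px; elim: n => [|n IHn]; first by rewrite !expg0 (fs_morph1 hf).
by rewrite !expgS (fs_morphM hf) ?groupX ?IHn.
Qed.

Lemma fs_morphJ P Q f x y :
  fs_hom F P Q f -> x \in P -> y \in P -> f (x ^ y) = f x ^ f y.
Proof.
move=> hf Px Py; rewrite /conjg !(fs_morphM hf) ?groupM ?groupV //.
by rewrite (fs_morphV hf).
Qed.

Lemma Aut_fsP P a : reflect (a \in Aut P /\ fs_hom F P P a) (a \in Aut_fs F P).
Proof. exact: setIdP. Qed.

Lemma Aut_fs_group_set P : P \subset S -> group_set (Aut_fs F P).
Proof.
move=> sPS; apply/group_setP; split=> [|a b].
  apply/Aut_fsP; split; first exact: group1.
  by apply: fs_ext (fs_incl (subxx P) sPS) => x _; rewrite perm1.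
case/Aut_fsP=> Aa ha /Aut_fsP[Ab hb]; apply/Aut_fsP; rewrite groupM //.
by split=> //; apply: fs_ext (fs_comp ha hb) => x _; rewrite permM.
Qed.

Lemma Aut_fs_of_hom P f : fs_hom F P P f ->
  exists2 a, a \in Aut_fs F P & {in P, a =1 f}.
Proof.
move=> hf; have injf := fs_injective hf.
have [_ _ sfP] := fs_inj hf.
have aE : {in P, perm_in injf sfP =1 f} by apply: perm_inE.
exists (perm_in injf sfP) => //; apply/Aut_fsP; split.
  rewrite inE perm_in_on; apply/morphicP=> x y Px Py.
  by rewrite !aE ?groupM // (fs_morphM hf).
by apply: fs_ext hf => x Px; rewrite aE.
Qed.

End FusionBasics.

(** * Fully normalized subgroups and extension to normalizers *)

Section Receptive.

Variables (p : nat) (gT : finGroupType) (S : {group gT}) (F : fusion_system S).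
Implicit Types P Q R : {group gT}.
Hypotheses (pS : p.-group S) (satF : saturated F p).

Lemma exists_fully_normalized R : R \subset S ->
  exists2 f, fs_hom F R S f &
    forall Q, Q :=: f @: R -> fully_normalized F Q.
Proof.
move=> sRS; pose P0 (f : {ffun gT -> gT}) := fs_hom F R S f.
have P0id: P0 [ffun x => x] by rewrite /P0 fs_hom_ffun fs_incl.
case: (@arg_maxnP _ _ _ (fun f : {ffun gT -> gT} => #|'N_S(f @: R)|) P0id) => f hf maxf.
exists (fun_of_fin f); first exact: hf.
move=> Q defQ g hg.
have hfQ: fs_hom F R Q f.
  by apply: (fs_corestr hf); [rewrite defQ | case: (fs_obj hg)].
have := maxf [ffun x => (g \o f) x]; rewrite /P0 fs_hom_ffun => /(_ (fs_comp hfQ hg)).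
rewrite /= defQ -imset_comp; congr (#|'N_S(_)| <= _).
by apply: eq_imset => x; rewrite ffunE.
Qed.

(** The automorphisms induced by N_S(R), transported by f, form a p-subgroup [B] of Aut_F(Q), in
    which Aut_S(Q) is a Sylow subgroup because Q is fully normalized. The automorphism a conjugates
    [B] into it. *)
Lemma receptive_adjust R Q f :
    fs_hom F R Q f -> Q :=: f @: R -> fully_normalized F Q ->
  exists2 a, a \in Aut_fs F Q & forall b, b \in 'N_S(R) ->
    exists2 b', b' \in 'N_S(Q) &
      {in R, forall x, a (f (x ^ b)) = a (f x) ^ b'}.
Proof.
move=> hf defQ nQ; have [sRS sQS] := fs_obj hf.
have [_ sylQ] := satF.1 Q sQS nQ.
pose fm := Morphism (fs_morphM hf).
have injf : 'injm fm by apply/injmP; apply: (fs_injective hf).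
have defQ' : fm @* R = Q by rewrite morphimEdom defQ.
pose B := Aut_isom injf (subxx R) @* (conj_aut R @* 'N_S(R)).
have sNR : conj_aut R @* 'N_S(R) \subset Aut R by apply: Aut_conj_aut.
have pB : p.-group B.
  by rewrite !morphim_pgroup // (pgroupS (subsetIl _ _)).
have BE b x : b \in 'N_S(R) -> x \in R ->
    Aut_isom injf (subxx R) (conj_aut R b) (f x) = f (x ^ b).
  move=> Nb Rx; rewrite (@Aut_isomE _ _ _ _ fm) //; last first.
    by rewrite (subsetP sNR) // mem_morphim //; case/setIP: Nb.
  by rewrite norm_conj_autE //; case/setIP: Nb.
have [g hg [fK gK]] := fs_inverse hf defQ.
have sBA : B \subset Aut_fs F Q.
  apply/subsetP=> _ /morphimP[_ _ /morphimP[b nb Nb ->] ->].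
  apply/Aut_fsP; split.
    by rewrite -defQ'; apply: (@Aut_Aut_isom _ _ _ _ fm).
  have [Sb _] := setIP Nb.
  have hb : fs_hom F R R (fun x => x ^ b).
    by apply: fs_conj => //; rewrite (normP nb).
  apply: fs_ext (fs_comp hg (fs_comp hb hf)) => y Qy /=.
  by rewrite -[in RHS](gK y Qy) BE // (fs_mem hg).
have [x Ax sBx] := Sylow_Jsub (G := Group (Aut_fs_group_set F sQS)) sylQ sBA pB.
have /Aut_fsP[AQx hx] := Ax.
exists x => // b Nb.
have Bb : Aut_isom injf (subxx R) (conj_aut R b) \in B.
  have [_ nb] := setIP Nb.
  by rewrite mem_morphim ?mem_morphim // (subsetP sNR) ?mem_morphim.
have /(subsetP sBx) /morphimP[b' nb' Nb' defb'] :
   Aut_isom injf (subxx R) (conj_aut R b) ^ x \in B :^ x by rewrite memJ_conjg.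
exists b' => // r Rr /=.
rewrite -BE // -(norm_conj_autE nb'); last first.
  by rewrite (fs_mem hx) // (fs_mem hf).
by rewrite -defb' permJ.
Qed.

(** The last hypothesis places all of N_S(R) in the extender of f, so the extension axiom reaches
    the full normalizer. *)
Lemma receptive_extend R Q f :
    fs_hom F R Q f -> Q :=: f @: R -> fully_centralized F Q ->
    (forall b, b \in 'N_S(R) ->
       exists2 b', b' \in 'N_S(Q) & {in R, forall x, f (x ^ b) = f x ^ b'}) ->
  exists2 g, fs_hom F ('N_S(R))%G S g & {in R, g =1 f}.
Proof.
move=> hf defQ cQ Nf; have [_ sQS] := fs_obj hf.
have hfS := fs_comp hf (fs_incl F sQS (subxx S)).
have [N [defN [g hg gE]]] := satF.2 R Q f hfS defQ cQ.
exists g; last exact: gE.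
apply: fs_res hg _; rewrite defN.
apply/subsetP=> b Nb; rewrite inE Nb /=; have [b' Nb' fb] := Nf b Nb.
apply/existsP; exists b'; rewrite -defQ Nb' /=.
by apply/forall_inP=> x Rx; rewrite fb.
Qed.

End Receptive.

(** * The hyperfocal subgroup *)

(** Since b^n f = f a^n on P and f maps onto Q, the order of b divides that of a. This covers maps
    with a kernel, such as [phi]. *)
Lemma p'elt_intertwine (p : nat) (gT1 gT2 : finGroupType) (P : {group gT1})
    (Q : {group gT2}) (a : {perm gT1}) (b : {perm gT2}) (f : gT1 -> gT2) :
    a \in Aut P -> b \in Aut Q -> Q :=: f @: P ->
    {in P, forall x, b (f x) = f (a x)} ->
  p^'.-elt a -> p^'.-elt b.
Proof.
move=> Aa Ab defQ bf p'a; apply: pnat_dvd p'a; rewrite order_dvdn.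
have bXf n x : x \in P -> (b ^+ n) (f x) = f ((a ^+ n) x).
  elim: n x => [|n IHn] x Px; first by rewrite !expg0 !perm1.
  by rewrite !expgS !permM bf // IHn // Aut_closed.
apply/eqP/(eq_Aut (A := Q)); rewrite ?groupX ?group1 // => y.
by rewrite defQ => /imsetP[x Px ->]; rewrite bXf // expg_order !perm1.
Qed.

Section Hyperfocal.

Variable p : nat.

Section PPrimeGenerated.

Variables (rT : finGroupType) (A : {group rT}).
Let B := [set a in A | p^'.-elt a].

Lemma p'elts_normal : <<B>> <| A.
Proof.
have sBA : B \subset A by apply/subsetP=> a /setIdP[].
rewrite /normal gen_subG sBA norms_gen //.
apply/subsetP=> x Ax; rewrite inE; apply/subsetP=> _ /imsetP[a /setIdP[Aa pa] ->].
by rewrite inE groupJ // p_eltJ.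
Qed.

(** An element of prime order q different from p in the quotient, lifted to x, is also the image of
    a p'-part of x; but that part lies in the kernel. *)
Lemma p'elts_index : p.-nat #|A : <<B>>|.
Proof.
rewrite -card_quotient ?normal_norm ?p'elts_normal //.
apply/pgroupP=> q q_pr dvq; have [y Ay oy] := Cauchy q_pr dvq.
apply: contraT => npq.
have [x Nx Ax defy] := morphimP Ay.
have p'y : p^'.-elt y by rewrite /p_elt oy pnatE.
have: y = 1.
  rewrite -(constt_p_elt p'y) defy -morph_constt //.
  rewrite /= coset_id // mem_gen // inE p_elt_constt andbT.
  by rewrite groupX.
by move=> y1; move: q_pr; rewrite -oy y1 order1.
Qed.

(** A normal subgroup of p-power index contains every p'-element, and the p'-elements already
    generate such a subgroup. *)
Lemma presidualE : presidual p A = <<B>>.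
Proof.
apply/eqP; rewrite eqEsubset; apply/andP; split.
  by apply: (bigcap_inf <<B>>%G); rewrite p'elts_normal p'elts_index.
rewrite gen_subG; apply/bigcapsP=> N /andP[nNA pAN].
apply/subsetP=> a /setIdP[Aa p'a].
have Na : a \in 'N(N) by apply: (subsetP (normal_norm nNA)).
apply: coset_idr => //; apply/eqP; rewrite -order_eq1.
apply/eqP/(@pnat_1 p).
  have: p.-group (A / N) by rewrite /pgroup card_quotient ?normal_norm.
  by move/mem_p_elt; apply; rewrite mem_quotient.
exact: morph_p_elt.
Qed.

End PPrimeGenerated.

Variables (gT : finGroupType) (S : {group gT}) (F : fusion_system S).
Implicit Types P Q R : {group gT}.

Canonical hyperfocal_group := Eval hnf in [group of hyperfocal p F].

(** The a with x^-1 a(x) in D for all x in P form a group, because x^-1 b(a x) = (x^-1 a x) ((a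
    x)^-1 b(a x)). So it is enough to test the p'-elements, which generate O^p(Aut_F(P)). *)
Lemma hyperfocal_subG (D : {group gT}) :
    (forall P a x, P \subset S -> a \in Aut_fs F P -> p^'.-elt a -> x \in P ->
       x^-1 * (a : {perm gT}) x \in D) ->
  hyperfocal p F \subset D.
Proof.
move=> sD; rewrite gen_subG; apply/bigcupsP=> P sPS; rewrite gen_subG.
pose AP := Group (Aut_fs_group_set F sPS).
pose E := [set a in AP | [forall x in P, x^-1 * (a : {perm gT}) x \in D]].
have gE : group_set E.
  apply/group_setP; split=> [|a b].
    rewrite inE group1; apply/forall_inP=> x _.
    by rewrite perm1 mulVg group1.
  case/setIdP=> Aa /forall_inP Da /setIdP[Ab /forall_inP Db].
  rewrite inE groupM //; apply/forall_inP=> x Px; rewrite permM.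
  have Pax : a x \in P by case/Aut_fsP: Aa => Aa _; rewrite Aut_closed.
  have -> : x^-1 * b (a x) = (x^-1 * a x) * ((a x)^-1 * b (a x)).
    by rewrite mulgA mulgK.
  by rewrite groupM ?Da ?Db.
have sPE : presidual p AP \subset Group gE.
  rewrite presidualE gen_subG; apply/subsetP=> a /setIdP[Aa pa].
  by rewrite inE Aa; apply/forall_inP=> x Px; apply: sD Px.
apply/subsetP=> _ /imset2P[x a Px /(subsetP sPE) Ea ->].
by case/setIdP: Ea => _ /forall_inP->.
Qed.

Lemma mem_hyperfocal P a x :
    P \subset S -> a \in Aut_fs F P -> p^'.-elt a -> x \in P ->
  x^-1 * (a : {perm gT}) x \in hyperfocal p F.
Proof.
move=> sPS Aa pa Px; apply/mem_gen/bigcupP; exists P => //.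
apply/mem_gen/imset2P; exists x a => //.
by rewrite (presidualE (Group (Aut_fs_group_set F sPS))) mem_gen // inE Aa.
Qed.

Lemma hyperfocal_sub : hyperfocal p F \subset S.
Proof.
apply: hyperfocal_subG => P a x sPS /Aut_fsP[Aa _] _ Px.
by rewrite groupM ?groupV ?(subsetP sPS) ?Aut_closed.
Qed.

Lemma hyperfocal_norm : S \subset 'N(hyperfocal p F).
Proof.
apply/subsetP=> s Ss; rewrite inE sub_conjg.
apply: (hyperfocal_subG (D := (hyperfocal_group :^ s^-1)%G)) => P a x sPS Aa pa Px /=.
rewrite mem_conjgV.
have /Aut_fsP[AP ha] := Aa.
have sPsS : P :^ s \subset S by rewrite -(conjGid Ss) conjSg.
have hs : fs_hom F P (P :^ s) (fun x => x ^ s) by apply: fs_conj.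
have hsV : fs_hom F (P :^ s)%G P (fun x => x ^ s^-1).
  by apply: fs_conj; rewrite ?groupV ?conjsgK.
have hb := fs_comp hsV (fs_comp ha hs).
have [b Ab bE] : exists2 b, b \in Aut_fs F (P :^ s)%G &
    {in (P :^ s)%G, b =1 fun y => a (y ^ s^-1) ^ s}.
  exact: Aut_fs_of_hom hb.
have -> : (x^-1 * a x) ^ s = (x ^ s)^-1 * b (x ^ s).
  by rewrite bE ?memJ_conjg // conjgK conjMg conjVg.
apply: (mem_hyperfocal (P := (P :^ s)%G)); rewrite ?memJ_conjg //.
have /Aut_fsP[APb _] := Ab.
apply: (p'elt_intertwine (f := fun x => x ^ s)) AP APb _ _ pa => //.
by move=> y Py; rewrite bE ?memJ_conjg ?conjgK.
Qed.

Lemma coset_hypJ x y : x \in S -> y \in S ->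
  coset (hyperfocal p F) (x ^ y)
    = coset (hyperfocal p F) x ^ coset (hyperfocal p F) y.
Proof. by move=> Sx Sy; rewrite morphJ // (subsetP hyperfocal_norm). Qed.

Definition inner_mod P (f : gT -> gT) :=
  exists2 s, s \in S &
    {in P, forall x, coset (hyperfocal p F) (f x) = coset (hyperfocal p F) (x ^ s)}.

Lemma inner_mod_comp P Q f g : fs_hom F P Q f -> fs_hom F Q S g ->
  inner_mod P f -> inner_mod Q g -> inner_mod P (g \o f).
Proof.
move=> hf hg [s Ss fE] [t St gE]; exists (s * t) => [|x Px /=].
  exact: groupM.
have [sPS sQS] := fs_obj hf.
have Sx := subsetP sPS x Px; have Sfx := subsetP sQS _ (fs_mem hf Px).
by rewrite gE ?(fs_mem hf) // conjgM !coset_hypJ ?groupJ // fE // coset_hypJ.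
Qed.

Lemma inner_mod_inv P R f g : fs_hom F P R f -> fs_hom F R P g ->
  {in R, cancel g f} -> inner_mod P f -> inner_mod R g.
Proof.
move=> hf hg gK [s Ss fE]; exists s^-1 => [|y Ry]; first by rewrite groupV.
have [sPS sRS] := fs_obj hf.
have Pgy := fs_mem hg Ry; have Sgy := subsetP sPS _ Pgy.
have Sy := subsetP sRS y Ry.
rewrite coset_hypJ ?groupV // -[in RHS](gK y Ry) fE //.
by rewrite -coset_hypJ ?groupV ?groupJ // conjgK.
Qed.

(** Modulo h, p'-automorphisms of Q act trivially and Aut_S(Q) acts by conjugation. The group [E] of
    automorphisms that are inner mod h contains both, so its index is a power of p and also prime to
    p. *)
Lemma inner_mod_Aut Q a : p.-Sylow(Aut_fs F Q) (Aut_conj S Q) -> Q \subset S ->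
  a \in Aut_fs F Q -> inner_mod Q a.
Proof.
move=> sylQ sQS; have nS := subsetP hyperfocal_norm.
pose A := Group (Aut_fs_group_set F sQS).
pose E := [set a in A | [exists s in S, [forall x in Q,
   coset (hyperfocal p F) ((a : {perm gT}) x) == coset (hyperfocal p F) (x ^ s)]]].
have EP a' : a' \in E -> a' \in A /\ inner_mod Q a'.
  case/setIdP=> -> /exists_inP[s Ss /forall_inP sE]; split=> //.
  by exists s => // x Qx; apply/eqP/sE.
have PE a' : a' \in A -> inner_mod Q a' -> a' \in E.
  move=> Aa [s Ss sE]; rewrite inE Aa; apply/exists_inP; exists s => //.
  by apply/forall_inP=> x Qx; apply/eqP/sE.
have homA a' : a' \in A -> fs_hom F Q Q a' by case/Aut_fsP.
have gE : group_set E.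
  apply/group_setP; split=> [|b c /EP[Ab ib] /EP[Ac ic]].
    apply: PE; first exact: group1.
    by exists 1 => // x _; rewrite perm1 conjg1.
  have [s Ss sE] := inner_mod_comp (homA _ Ab)
     (fs_comp (homA _ Ac) (fs_incl F sQS (subxx S))) ib ic.
  apply: PE; first exact: groupM.
  by exists s => // x Qx; rewrite permM sE.
suffices sAE : A \subset Group gE by move/(subsetP sAE)/EP => [].
have sNE : <<[set b in A | p^'.-elt b]>> \subset Group gE.
  rewrite gen_subG; apply/subsetP=> b /setIdP[Ab pb]; apply: PE => //.
  exists 1 => // x Qx; rewrite conjg1.
  have Qbx : (b : {perm gT}) x \in Q by apply: fs_mem (homA _ Ab) Qx.
  apply/esym/rcoset_kercosetP; rewrite ?nS ?(subsetP sQS) //.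
  rewrite mem_rcoset; rewrite -(memJ_norm _ (nS _ (subsetP sQS _ Qbx))).
  rewrite conjgE mulgKV -groupV invMg invgK.
  exact: mem_hyperfocal Qx.
have sUE : Aut_conj S Q \subset Group gE.
  apply/subsetP=> b Ub; apply: PE; first by case/and3P: sylQ => /subsetP->.
  have [s nQs /setIP[Ss _] ->] := morphimP Ub.
  by exists s => // x Qx; rewrite /= norm_conj_autE.
rewrite -indexg_eq1; apply/eqP/(@pnat_1 p).
  exact: pnat_dvd (indexgS _ sNE) (p'elts_index A).
case/and3P: sylQ => _ _; apply: pnat_dvd.
exact: (@indexgS _ A (conj_aut Q @* 'N_S(Q))%G (Group gE)).
Qed.

(** The induction behind Alperin's theorem. A morphism from R onto a fully normalized Q extends,
    after an automorphism of Q, to N_S(R), which is larger than R. A general f is g f followed by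
    the inverse of g, where both g and g f map onto a fully normalized subgroup. *)
Lemma fs_inner_mod : p.-group S -> saturated F p ->
  forall P f, fs_hom F P S f -> inner_mod P f.
Proof.
move=> pS satF P; have [n] := ubnP (#|S| - #|P|).
elim: n P => // n IHn P leP f hf.
have [sPS _] := fs_obj hf.
(* Stated for every R of order |P|, since it serves for g f on P and for g on f(P). *)
have onto_nor R Q g : #|R| = #|P| -> fs_hom F R Q g -> Q :=: g @: R ->
    fully_normalized F Q -> inner_mod R g.
  move=> oR hg defQ nQ; have [sRS sQS] := fs_obj hg.
  have [cQ sylQ] := satF.1 Q sQS nQ.
  have [a Aa aN] := receptive_adjust pS satF hg defQ nQ.
  have /Aut_fsP[AQa ha] := Aa.
  have hag := fs_comp hg ha.
  have defQa : Q :=: (a \o g) @: R.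
    rewrite imset_comp -defQ; apply/esym/eqP; rewrite eqEcard card_imset.
      by rewrite leqnn andbT; case: (fs_inj ha).
    exact: perm_inj.
  have iag : inner_mod R (a \o g).
    (* For R = S there is no larger normalizer, but the morphism is then an automorphism of S. *)
    have [eqRS | neqRS] := eqVneq (R : {set gT}) S.
      have eRS : R = S by apply: val_inj.
      have eQS : Q = S.
        have oQ : #|Q| = #|R|.
          by rewrite defQ card_in_imset //; apply: fs_injective hg.
        by apply/val_inj/eqP; rewrite eqEcard sQS /= oQ eqRS.
      move: hag sylQ; rewrite eRS eQS => hag sylS.
      have [b Ab bE] := Aut_fs_of_hom hag.
      have [s Ss sE] := inner_mod_Aut sylS (subxx S) Ab.
      by exists s => // x Sx; rewrite -bE // sE.
    have [h hh hE] := receptive_extend satF hag defQa cQ aN.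
    have ltRN : R \proper 'N_S(R).
      apply: nilpotent_proper_norm; first exact: pgroup_nil pS.
      by rewrite properEneq neqRS.
    have [|s Ss sE] := IHn _ _ h hh.
      have := proper_card ltRN; have := subset_leq_card (subsetIl S 'N(R)).
      rewrite oR => le1 lt2; rewrite ltnS in leP.
      apply: leq_trans leP; rewrite ltn_sub2l //.
      exact: leq_trans lt2 le1.
    exists s => // x Rx; rewrite -hE // sE //.
    by rewrite (subsetP (proper_sub ltRN)).
  have ia : inner_mod Q a by apply: inner_mod_Aut.
  have [b hb [aK bK]] : exists2 b, fs_hom F Q Q b & {in Q, cancel a b} /\ {in Q, cancel b a}.
    apply: fs_inverse => //; apply/esym/eqP; rewrite eqEcard card_imset.
      by rewrite leqnn andbT; case: (fs_inj ha).
    exact: perm_inj.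
  have ib := inner_mod_inv ha hb bK ia.
  have [s Ss sE] := inner_mod_comp hag (fs_comp hb (fs_incl F sQS (subxx S))) iag ib.
  by exists s => // x Rx; rewrite -sE //= aK // (fs_mem hg).
have [R defR hfR] := fs_onto hf; have [_ sRS] := fs_obj hfR.
have [g hg ng] := exists_fully_normalized F sRS.
have [Q defQ hgQ] := fs_onto hg; have nQ := ng Q defQ.
have [_ sQS] := fs_obj hgQ.
have oR : #|R| = #|P| by rewrite defR card_in_imset //; apply: fs_injective hf.
have ig := onto_nor R Q g oR hgQ defQ nQ.
have igf : inner_mod P (g \o f).
  apply: (onto_nor P Q) => //; first exact: fs_comp hfR hgQ.
  by rewrite imset_comp -defR.
have [k hk [gK kK]] := fs_inverse hgQ defQ.
have ik := inner_mod_inv hgQ hk kK ig.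
have [s Ss sE] := inner_mod_comp (fs_comp hfR hgQ)
  (fs_comp hk (fs_incl F sRS (subxx S))) igf ik.
by exists s => // x Px; rewrite -sE //= gK // (fs_mem hfR).
Qed.

End Hyperfocal.

(** * Marks of virtual permutation sets *)

Section Marks.

Variables (gT : finGroupType) (G : {group gT}).
Implicit Types (H K L M : {group gT}) (w : {group gT} -> int).

Definition fixc (H : {group gT}) (K : {set gT}) : nat :=
  #|'Fix_(rcosets H G | 'Rs)(K)|.

(** The number of fixed points of K on the virtual G-set with w(H) copies of G/H. Weights live on
    subgroups instead of conjugacy classes, so several H may give isomorphic orbits. *)
Definition mark w (K : {set gT}) : int :=
  (\sum_(H : {group gT} | H \subset G) w H * (fixc H K)%:R)%R.

Lemma fixcJ H (K : {set gT}) g : g \in G -> fixc H (K :^ g) = fixc H K.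
Proof.
have le_fix (A : {set gT}) x : x \in G -> fixc H A <= fixc H (A :^ x).
  move=> Gx; rewrite /fixc -(card_imset _ (act_inj 'Rs x)); apply: subset_leq_card.
  apply/subsetP=> _ /imsetP[C /setIP[/rcosetsP[y Gy ->{C}] fC] ->] /=.
  move: fC; rewrite rcosetE -rcosetM => fC; rewrite inE sub_afixRs_norms.
  rewrite conjsgM conjSg -sub_afixRs_norms fC andbT.
  by apply/rcosetsP; exists (y * x); rewrite ?groupM.
move=> Gg; apply/eqP; rewrite eqn_leq le_fix // andbT.
by rewrite -{2}(conjsgK g K) le_fix ?groupV.
Qed.

Lemma fixc_conj H K : K \subset G -> fixc H K != 0%N ->
  exists2 g, g \in G & K \subset H :^ g.
Proof.
move=> sKG; rewrite -lt0n => /card_gt0P[C /setIP[/rcosetsP[y Gy ->{C}] fC]].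
by exists y => //; rewrite -sub_afixRs_norms.
Qed.

Lemma fixc_self H : H \subset G -> fixc H H = #|'N_G(H) : H|.
Proof. by move=> sHG; rewrite /fixc afixRs_rcosets. Qed.

Lemma markJ w (K : {set gT}) g : g \in G -> mark w (K :^ g) = mark w K.
Proof. by move=> Gg; apply: eq_bigr => H _; rewrite fixcJ. Qed.

(** M acts on the cosets fixed by K, and n in M fixes those that K<n> fixes; for each H the
    Cauchy-Frobenius formula makes the sum |M| times a number of orbits. *)
Lemma mark_burnside w (M K : {group gT}) : M \subset 'N_G(K) -> K \subset G ->
  (#|M| %| (\sum_(n in M) mark w (K <*> <[n]>))%R)%Z.
Proof.
rewrite subsetI => /andP[sMG nKM] sKG; rewrite exchange_big /=.
apply: rpred_sum => H sHG; rewrite -mulr_sumr dvdz_mull //.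
have actsM : [acts M, on 'Fix_(rcosets H G | 'Rs)(K) | 'Rs].
  apply: actsI; first exact: subset_trans sMG (actsRs_rcosets H G).
  have := acts_subnorm_fix 'Rs K; rewrite !setTI; exact: subset_trans.
have -> : (\sum_(n in M) (fixc H (K <*> <[n]>))%:R =
    (\sum_(n in M) #|'Fix_('Fix_(rcosets H G | 'Rs)(K) | 'Rs)[n]|)%N%:R :> int)%R.
  rewrite natr_sum; apply: eq_bigr => n Mn; congr (_%:R)%R; apply: eq_card => C.
  by rewrite /fixc joingE afix_gen afixU afix_cycle setIA.
by rewrite (Frobenius_Cauchy actsM) natrM dvdz_mull // natz.
Qed.

Definition conj_rep H : {group gT} := odflt H [pick R in orbit 'JG G H].

Lemma conj_repP H : exists2 g, g \in G & conj_rep H = (H :^ g)%G.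
Proof.
rewrite /conj_rep; case: pickP => [R /orbitP[g Gg <-] | _] /=; first by exists g.
by exists 1 => //; apply: val_inj; rewrite /= conjsg1.
Qed.

Lemma conj_repJ H g : g \in G -> conj_rep (H :^ g)%G = conj_rep H.
Proof.
move=> Gg; have eqo : orbit 'JG G (H :^ g)%G = orbit 'JG G H.
  exact: (orbit_act 'JG H Gg).
rewrite /conj_rep eqo; case: pickP => // /(_ H).
by rewrite orbit_refl.
Qed.

Variable HH : pred {group gT}.
Hypothesis HHsG : forall K, HH K -> K \subset G.
Hypothesis HHJ : forall K g, g \in G -> HH K -> HH (K :^ g)%G.

Definition supported w := forall H, w H != 0%R -> HH H.

(** The correction [d] sits on one representative of each class of order k. A K of order at least k
    that fixes a coset of such a representative is conjugate to it. So marks above k stay, and at K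
    of order k only its own representative contributes, with mark |N_G(K) : K|; hence the
    divisibility condition. *)
Lemma mark_adjust k w (m : {group gT} -> int) :
    supported w ->
    (forall K g, HH K -> #|K| = k -> g \in G -> m (K :^ g)%G = m K) ->
    (forall K, HH K -> #|K| = k -> (#|'N_G(K) : K| %| (m K - mark w K)%R)%Z) ->
  exists w', [/\ supported w',
    forall K, HH K -> #|K| = k -> mark w' K = m K
    & forall K, HH K -> k < #|K| -> mark w' K = mark w K].
Proof.
move=> sw mJ mdiv.
pose d H : int := if [&& HH H, #|H| == k & conj_rep H == H]
  then ((m H - mark w H)%R %/ #|'N_G(H) : H|)%Z else 0%R.
have dP H : d H != 0%R -> [/\ HH H, #|H| = k & conj_rep H = H].
  by rewrite /d; case: ifP; rewrite ?eqxx // => /and3P[-> /eqP-> /eqP->].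
have markD K : mark (fun H => w H + d H)%R K = (mark w K + mark d K)%R.
  by rewrite -big_split; apply: eq_bigr => H _; rewrite mulrDl.
have d0 H K : HH K -> d H != 0%R -> fixc H K != 0%N ->
    exists2 g, g \in G & K \subset H :^ g.
  by move=> hK _; apply: fixc_conj; apply: HHsG.
exists (fun H => w H + d H)%R; split=> [H|K hK oK|K hK ltk].
- have [->|/dP[]//] := eqVneq (d H) 0%R; rewrite addr0; exact: sw.
- have [g Gg repK] := conj_repP K; pose R := conj_rep K.
  have hR : HH R by rewrite /R repK HHJ.
  have oR : #|R| = k by rewrite /R repK cardJg.
  have repR : conj_rep R = R by rewrite {1}/R repK conj_repJ.
  have sKG := HHsG hK.
  rewrite markD {2}/mark (bigD1 R) ?HHsG //= [X in (_ + (_ + X))%R]big1 => [|H /andP[sHG neHR]].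
    rewrite addr0 /d hR oR eqxx repR eqxx /=.
    have -> : fixc R K = #|'N_G(R) : R|.
      rewrite -fixc_self ?HHsG // -[in RHS](fixcJ R _ (groupVr Gg)).
      by rewrite /R repK /= conjsgK.
    rewrite natz divzK; last exact: mdiv.
    have -> : m R = m K by rewrite /R repK mJ.
    have -> : mark w R = mark w K by rewrite /R repK /= markJ.
    by rewrite addrC subrK.
  apply/eqP; rewrite mulf_eq0; apply: contraR neHR; rewrite negb_or.
  rewrite pnatr_eq0 => /andP[dH fH]; have [_ oH repH] := dP H dH.
  have [x Gx sKH] := d0 H K hK dH fH.
  have KH : K = (H :^ x)%G.
    by apply/val_inj/eqP; rewrite eqEcard sKH /= cardJg oH oK leqnn.
  by rewrite /R KH conj_repJ // repH.
rewrite markD [X in (_ + X)%R]big1 ?addr0 // => H sHG.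
apply/eqP; rewrite mulf_eq0; apply: contraLR ltk; rewrite negb_or -leqNgt.
rewrite pnatr_eq0 => /andP[dH fH]; have [_ oH _] := dP H dH.
have [x Gx sKH] := d0 H K hK dH fH.
by rewrite -oH -(cardJg H x) subset_leq_card.
Qed.

Hypothesis HHS : forall K L, HH K -> L \subset K -> HH L.

Lemma mark_unsupported w K : K \subset G -> supported w -> ~~ HH K -> mark w K = 0%R.
Proof.
move=> sKG sw nK; apply: big1 => H sHG; apply/eqP; rewrite mulf_eq0.
apply: contraR nK; rewrite negb_or pnatr_eq0 => /andP[/sw hH].
by case/fixc_conj=> // g Gg; apply: HHS; apply: HHJ.
Qed.

(* [c K] labels the class of [K] for a relation coarser than conjugacy in [G],
   [star (c K)] is a member of that class whose normalizer absorbs the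
   normalizers of all the other members. *)
Variables (T : eqType) (c : {group gT} -> T) (star : T -> {group gT}).
Hypothesis cJ : forall K g, g \in G -> HH K -> c (K :^ g)%G = c K.
Hypothesis c_card : forall K L, HH K -> HH L -> c K = c L -> #|K| = #|L|.
Hypothesis star_lift : forall K, HH K -> let K0 := star (c K) in
  [/\ HH K0, c K0 = c K & exists2 g, g \in G &
    exists2 h : {morphism 'N_G(K :^ g) >-> gT}, 'injm h &
      [/\ h @* (K :^ g) = K0, h @* 'N_G(K :^ g) \subset G &
        forall L : {group gT}, K :^ g \subset L -> L \subset 'N_G(K :^ g) ->
          HH (h @* L)%G = HH L /\ (HH L -> c (h @* L)%G = c L)]].

Definition stable_above n w := forall K L,
  HH K -> HH L -> c K = c L -> n < #|K| -> mark w K = mark w L.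

(** [mark_burnside] is applied to N_G(K^g) and to its image under the injective lift h, and the sums
    are subtracted. For n outside K^g, the group K^g<n> and its image are either larger members of
    one class, with equal marks, or both outside [HH], with marks 0. There remain |K| terms, each
    the difference of the two marks. *)
Lemma mark_congruence w K : supported w -> HH K -> stable_above #|K| w ->
  (#|'N_G(K) : K| %| (mark w (star (c K)) - mark w K)%R)%Z.
Proof.
move=> sw hK stw; have [hK0 cK0 [g Gg [h injh [hK1 sNG hL]]]] := star_lift hK.
set K0 := star (c K) in hK0 cK0 hK1 *.
pose K1 := (K :^ g)%G; pose N := 'N_G(K1)%G.
have sK1N : K1 \subset N.
  by rewrite subsetI normG andbT; apply: HHsG; apply: HHJ.
have -> : mark w K = mark w K1 by rewrite /= markJ.
have -> : #|'N_G(K) : K| = #|N : K1|.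
  by rewrite /= normJ -{2}(conjGid Gg) -conjIg indexJg.
have sNN : h @* N \subset 'N_G(K0).
  by rewrite subsetI sNG -hK1 morphim_norms // subsetIr.
have div1 := mark_burnside w (subxx N) (HHsG (HHJ Gg hK)).
have := mark_burnside w sNN (HHsG hK0).
rewrite card_injm // => div2; have := rpredB div2 div1.
rewrite /= morphimEdom big_imset /=; last exact/injmP.
rewrite -sumrB (bigID (mem K1)) /= [X in (_ + X)%R]big1 ?addr0; last first.
  move=> n /andP[Nn K1'n]; pose L := (K1 <*> <[n]>)%G.
  have sLN : L \subset N by rewrite join_subG sK1N cycle_subG.
  have sK1L : K1 \subset L by apply: joing_subl.
  have defhL : h @* L = K0 <*> <[h n]>.
    by rewrite morphimY ?cycle_subG // hK1 morphim_cycle.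
  have [HHhL chL] := hL L sK1L sLN; rewrite -/(gval L) -defhL.
  have [hL' | nhL] := boolP (HH L); last first.
    rewrite !mark_unsupported ?subr0 //; last by rewrite HHhL.
      exact: subset_trans sLN (subsetIl _ _).
    by apply: subset_trans sNG; apply: morphimS.
  have ltKL : #|K| < #|L|.
    rewrite -(cardJg K g) proper_card // properEneq sK1L andbT.
    apply: contraNneq K1'n => ->.
    by rewrite -cycle_subG joing_subr.
  apply/eqP; rewrite subr_eq0; apply/eqP/esym/(stw L (h @* L)%G) => //.
    by rewrite HHhL.
  by rewrite chL.
rewrite (eq_bigr (fun _ => mark w K0 - mark w K1)%R) => [|n /andP[Nn K1n]]; last first.
  have snK1 : <[n]> \subset K1 by rewrite cycle_subG.
  have snK0 : <[h n]> \subset K0 by rewrite cycle_subG -hK1 mem_morphim.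
  by rewrite (joing_idPl snK1) (joing_idPl snK0).
rewrite sumr_const.
have -> : #|[pred n | n \in N & n \in K1]| = #|K1|.
  by apply: eq_card => n; apply: andb_idl; apply: (subsetP sK1N).
rewrite -mulr_natl natz -(Lagrange sK1N) PoszM dvdz_mul2l //.
by rewrite -lt0n cardG_gt0.
Qed.

(** At order n + 1 all marks of a class are set to that of its [star], which [mark_congruence]
    allows and which leaves larger orders alone. *)
Lemma exists_stable n w : supported w -> stable_above n w ->
  exists w', [/\ supported w', stable_above 0 w' &
    forall K, HH K -> n < #|K| -> mark w' K = mark w K].
Proof.
elim: n w => [|n IHn] w sw stw; first by exists w.
have [|K hK oK|w1 [sw1 m1 M1]] := @mark_adjust n.+1 w (fun K => mark w (star (c K))) sw.
- by move=> K g hK oK Gg; rewrite cJ.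
- by apply: mark_congruence => //; rewrite oK.
have st1 : stable_above n w1.
  move=> K L hK hL cKL; have oKL := c_card hK hL cKL.
  rewrite leq_eqVlt => /predU1P[oK | ltK]; first by rewrite !m1 -?oKL ?cKL.
  by rewrite !M1 -?oKL // (stw K L).
have [w' [sw' st' M']] := IHn w1 sw1 st1; exists w'; split=> // K hK ltK.
by rewrite M' ?M1 // ltnW.
Qed.

End Marks.

(** * The characteristic biset *)

Section Graphs.

Variables (gT : finGroupType) (S : {group gT}) (F : fusion_system S).
Implicit Types (P Q R : {group gT}) (K L : {group gT * gT}).

Local Notation G := (setX_group S S).

Definition fs_graph : pred {group gT * gT} := fun K =>
  [exists P : {group gT}, exists f : {ffun gT -> gT},
    fs_hom F P S f && (K == [set (x, f x) | x in P] :> {set gT * gT})].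

Definition proj2 K : {group gT} := (snd_morphism gT gT @* K)%G.

Lemma fs_graphI K P f : fs_hom F P S f ->
  (forall z, (z \in K) = (z.1 \in P) && (z.2 == f z.1)) -> fs_graph K.
Proof.
move=> hf Kf; apply/existsP; exists P; apply/existsP; exists [ffun x => f x].
rewrite fs_hom_ffun hf; apply/eqP/setP=> -[x y]; rewrite Kf /=.
apply/andP/imsetP=> [[Px /eqP->] | [u Pu [-> ->]]].
  by exists x; rewrite ?ffunE.
by rewrite Pu ffunE.
Qed.

Lemma fs_graphP K : fs_graph K -> exists P, exists2 f, fs_hom F P S f &
  forall z, (z \in K) = (z.1 \in P) && (z.2 == f z.1).
Proof.
case/existsP=> P /existsP[f /andP[hf /eqP defK]]; exists P, f => // -[x y].
rewrite defK /=; apply/imsetP/andP=> [[u Pu [-> ->]] | [Px /eqP->]].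
  by rewrite Pu eqxx.
by exists x.
Qed.

Lemma mem_proj2 K y : reflect (exists x, (x, y) \in K) (y \in proj2 K).
Proof.
rewrite /= morphimEsub ?subsetT //.
apply: (iffP imsetP) => [[[x z] Kxz ->] | [x Kxy]]; first by exists x.
by exists (x, y).
Qed.

Lemma fs_graph_sub K : fs_graph K -> K \subset G.
Proof.
case/fs_graphP=> P [f hf Kf]; have [/subsetP sPS _] := fs_obj hf.
apply/subsetP=> -[x y]; rewrite Kf /= => /andP[Px /eqP->].
by rewrite inE /= sPS // (fs_mem hf).
Qed.

Lemma fs_graphS K L : fs_graph K -> L \subset K -> fs_graph L.
Proof.
case/fs_graphP=> P [f hf Kf] /subsetP sLK.
pose Q := (fst_morphism gT gT @* L)%G.
have QP x : reflect (exists y, (x, y) \in L) (x \in Q).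
  rewrite /= morphimEsub ?subsetT //.
  apply: (iffP imsetP) => [[[u y] Lxy ->] | [y Lxy]]; first by exists y.
  by exists (x, y).
apply: (@fs_graphI L Q f) => [|[x y] /=].
  apply: fs_res hf _; apply/subsetP=> x /QP[y /sLK].
  by rewrite Kf => /andP[].
apply/idP/andP=> [Lxy | [/QP[z Lxz] /eqP->]].
  by split; [apply/QP; exists y | move: (sLK _ Lxy); rewrite Kf => /andP[]].
by move: (sLK _ Lxz); rewrite Kf => /andP[_ /eqP <-].
Qed.

Lemma fs_graphJ K g : g \in G -> fs_graph K -> fs_graph (K :^ g)%G.
Proof.
case: g => a b; rewrite inE => /andP[/= Sa Sb] /fs_graphP[P [f hf Kf]].
have [sPS _] := fs_obj hf.
have sPaS : P :^ a \subset S by rewrite -(conjGid Sa) conjSg.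
have hc : fs_hom F (P :^ a)%G P (fun x => x ^ a^-1).
  by apply: fs_conj; rewrite ?groupV ?conjsgK.
have hd : fs_hom F S S (fun x => x ^ b) by apply: fs_conj; rewrite ?conjGid.
apply: (fs_graphI (fs_comp hc (fs_comp hf hd))) => -[x y] /=.
rewrite mem_conjg Kf mem_conjg.
rewrite -[((x, y) ^ _).1]/(x ^ a^-1) -[((x, y) ^ _).2]/(y ^ b^-1).
by rewrite -[in RHS](inj_eq (conjg_inj b^-1)) conjgK.
Qed.

Lemma proj2J K g : proj2 (K :^ g)%G = (proj2 K :^ g.2)%G.
Proof.
by apply: val_inj; rewrite /= morphimJ ?inE.
Qed.

Lemma card_proj2 K : fs_graph K -> #|proj2 K| = #|K|.
Proof.
case/fs_graphP=> P [f hf Kf]; rewrite /= morphimEsub ?subsetT //.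
rewrite card_in_imset // => -[x y] [u v]; rewrite !Kf /=.
case/andP=> Px /eqP-> /andP[Pu /eqP->] /(fs_injective hf) eqxu.
by rewrite eqxu.
Qed.

(** Graphs with the same second projection differ by an isomorphism of F between their domains.
    Marks constant on these classes are thus F-stable in the first coordinate. *)
Definition graph_class K : {group gT} := conj_rep S (proj2 K).

Lemma graph_classJ K g : g \in G -> graph_class (K :^ g)%G = graph_class K.
Proof.
by case: g => a b /[!inE] /andP[/= _ Sb]; rewrite /graph_class proj2J conj_repJ.
Qed.

Lemma card_graph_class K : fs_graph K -> #|graph_class K| = #|K|.
Proof.
move=> hK; rewrite /graph_class; have [s _ ->] := conj_repP S (proj2 K).
by rewrite cardJg card_proj2.
Qed.

Variable p : nat.
Hypotheses (pS : p.-group S) (satF : saturated F p).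

(** K is the graph of the inverse Q -> R of f. The condition on b says that the extender of f is all
    of N_S(R). *)
Definition receptive_graph R K := exists Q, exists2 f,
    [/\ fs_hom F R Q f, Q :=: f @: R, fully_centralized F Q &
        forall b, b \in 'N_S(R) ->
          exists2 b', b' \in 'N_S(Q) & {in R, forall x, f (x ^ b) = f x ^ b'}]
    & forall z, (z \in K) = (z.2 \in R) && (z.1 == f z.2).

Lemma exists_receptive_graph R : R \subset S -> exists K, receptive_graph R K.
Proof.
move=> sRS.
have [f1 hf1 nf] := exists_fully_normalized F sRS.
have [Q defQ hf1Q] := fs_onto hf1; have nQ := nf Q defQ.
have [a Aa aN] := receptive_adjust pS satF hf1Q defQ nQ.
have [cQ _] := satF.1 Q (fs_obj hf1Q).2 nQ.
have /Aut_fsP[_ ha] := Aa; have hf := fs_comp hf1Q ha; set f := a \o f1 in hf.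
have grK : group_set [set (f x, x) | x in R].
  apply/group_setP; split=> [|_ _ /imsetP[x Rx ->] /imsetP[y Ry ->]].
    by apply/imsetP; exists 1; rewrite ?group1 ?(fs_morph1 hf).
  by apply/imsetP; exists (x * y); rewrite ?groupM ?(fs_morphM hf).
exists (Group grK), Q, f.
  split=> //; rewrite imset_comp -defQ; apply/esym/eqP.
  rewrite eqEcard card_imset ?leqnn ?andbT; last exact: perm_inj.
  by case: (fs_inj ha).
move=> [y x] /=; apply/imsetP/andP=> [[u Ru [-> ->]] | [Rx /eqP->]].
  by rewrite Ru eqxx.
by exists x.
Qed.

(** After conjugation K is the graph of f : P -> R, and [star R] comes from e : R -> Q. If (a, b)
    normalizes the graph, then f carries conjugation by a to conjugation by b, and e carries this to
    conjugation by an element of N_S(Q). So a lies in the extender of e f, and an extension g of e f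
    gives h(a, b) = (g a, b). Second coordinates do not change, hence neither do classes. *)
Lemma receptive_graph_lift (star : {group gT} -> {group gT * gT}) :
    (forall R, R \subset S -> receptive_graph R (star R)) ->
  forall K, fs_graph K -> let K0 := star (graph_class K) in
  [/\ fs_graph K0, graph_class K0 = graph_class K & exists2 g, g \in G &
    exists2 h : {morphism 'N_G(K :^ g) >-> (gT * gT)%type}, 'injm h &
      [/\ h @* (K :^ g) = K0, h @* 'N_G(K :^ g) \subset G &
        forall L, K :^ g \subset L -> L \subset 'N_G(K :^ g) ->
          fs_graph (h @* L)%G = fs_graph L /\
          (fs_graph L -> graph_class (h @* L)%G = graph_class L)]].
Proof.
move=> starP K hK K0.
pose R := graph_class K; have [s Ss defR] := conj_repP S (proj2 K).
rewrite -/(graph_class K) -/R in defR.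
have Gs : (1, s) \in G by rewrite inE group1.
pose K1 := (K :^ (1%g, s))%G.
have hK1 : fs_graph K1 by apply: fs_graphJ.
have K1R : proj2 K1 = R by rewrite proj2J defR.
have [P [f hf K1f]] := fs_graphP hK1.
have fP : R :=: f @: P.
  apply/setP=> y; rewrite -K1R; apply/mem_proj2/imsetP=> [[x] | [x Px ->]].
    by rewrite K1f => /andP[/= Px /eqP->]; exists x.
  by exists x; rewrite K1f /= Px eqxx.
have sRS : R \subset S by rewrite fP; case: (fs_inj hf).
have [Q [e [he defQ cQ eN] starR]] := starP R sRS.
have [e' he' [eK e'K]] := fs_inverse he defQ.
have hfR : fs_hom F P R f by apply: fs_corestr hf _ sRS; rewrite fP.
have [_ sQS] := fs_obj he.
have hefQ := fs_comp hfR he; have hef := fs_comp hefQ (fs_incl F sQS (subxx S)).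
have defQf : Q :=: (e \o f) @: P by rewrite imset_comp -fP.
have [N [defN [g hg gE]]] := satF.2 P Q (e \o f) hef defQf cQ.
have hK0 : fs_graph K0.
  apply: (@fs_graphI _ Q e') => [|[x y] /=].
    exact: fs_comp he' (fs_incl F sRS (subxx S)).
  rewrite starR /=; apply/andP/andP=> [[Ry /eqP->] | [Qx /eqP->]].
    by rewrite eK // eqxx (fs_mem he).
  by rewrite e'K // eqxx (fs_mem he').
have K0R : proj2 K0 = R.
  apply/val_inj/setP=> y; apply/mem_proj2/idP=> [[x] | Ry].
    by rewrite starR => /andP[].
  by exists (e y); rewrite starR /= Ry eqxx.
split=> //.
  by rewrite /graph_class K0R defR conj_repJ.
exists (1, s) => //.
have fJ x a b : x \in P -> (a, b) \in 'N_G(K1) ->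
    x ^ a \in P /\ f (x ^ a) = f x ^ b.
  move=> Px /setIP[_ nK]; have Kx : (x, f x) \in K1 by rewrite K1f /= Px eqxx.
  have : (x, f x) ^ (a, b) \in K1 by rewrite memJ_norm.
  by rewrite K1f => /andP[Pxa /eqP fxa]; split; [exact: Pxa | rewrite -fxa].
have memN z : z \in 'N_G(K1) -> z.1 \in N.
  case: z => a b nKz; have /setIP[/setXP[/= Sa Sb] _] := nKz.
  have nPa : a \in 'N_S(P).
    rewrite !inE Sa; apply/subsetP=> _ /imsetP[x Px ->].
    by case: (fJ x a b).
  have nRb : b \in 'N_S(R).
    rewrite !inE Sb; apply/subsetP=> _ /imsetP[_ /[!fP]/imsetP[x Px ->] ->].
    by have [Pxa <-] := fJ x a b Px nKz; rewrite imset_f.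
  have [b' nb' eb'] := eN b nRb.
  rewrite /= defN inE nPa; apply/existsP; exists b'; rewrite -defQf nb'.
  apply/forall_inP=> x Px; have [Pxa fxa] := fJ x a b Px nKz.
  by rewrite /= fxa eb' ?(fs_mem hfR).
pose h0 (z : gT * gT) := (g z.1, z.2).
have h0M : {in 'N_G(K1) &, {morph h0 : z t / z * t}}.
  by move=> z t Nz Nt; rewrite /h0 /= (fs_morphM hg) ?memN.
pose h := Morphism h0M.
have mem_h (L : {group gT * gT}) x y : L \subset 'N_G(K1) ->
    reflect (exists2 a, (a, y) \in L & x = g a) ((x, y) \in (h @* L)%G).
  move=> sLN; rewrite /= morphimEsub //.
  apply: (iffP imsetP) => [[[a b] Lab [-> ->]] | [a Lab ->]]; first by exists a.
  by exists (a, y).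
have sK1N : K1 \subset 'N_G(K1) by rewrite subsetI normG fs_graph_sub.
exists h.
  apply/injmP=> -[a b] [a' b'] Nz Nz' [/(fs_injective hg) eqa ->].
  by rewrite eqa ?(memN (a, b)) ?(memN (a', b')).
split.
- apply/setP=> -[x y]; rewrite starR /=.
  apply/(mem_h K1 _ _ sK1N)/andP=> [[a] | [Ry /eqP->]].
    rewrite K1f /= => /andP[Pa /eqP->] ->; rewrite gE //=.
    by rewrite (fs_mem hfR).
  move: Ry; rewrite fP => /imsetP[a Pa ->]; exists a; last by rewrite gE.
  by rewrite K1f /= Pa eqxx.
- apply/subsetP=> -[x y] /(mem_h ('N_G(K1))%G _ _ (subxx _))[a Na ->].
  have /setIP[/setXP[/= _ Sy] _] := Na.
  by rewrite inE /= Sy andbT (fs_mem hg) // (memN (a, y)).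
move=> L sK1L sLN; have sLN' := subsetP sLN; split; last first.
  move=> hL; rewrite /graph_class; congr (conj_rep S _); apply/val_inj/setP=> y.
  apply/mem_proj2/mem_proj2=> [[x /(mem_h L _ _ sLN)[a La _]] | [a La]].
    by exists a.
  by exists (g a); apply/(mem_h L _ _ sLN); exists a.
apply/idP/idP => [/fs_graphP[P2 [f2 hf2 Lf2]] | /fs_graphP[P1 [f1 hf1 Lf1]]].
  pose P1 := (fst_morphism gT gT @* L)%G.
  have P1P x : reflect (exists y, (x, y) \in L) (x \in P1).
    rewrite /= morphimEsub ?subsetT //.
    apply: (iffP imsetP) => [[[u y] Lxy ->] | [y Lxy]]; first by exists y.
    by exists (x, y).
  have sP1N : P1 \subset N by apply/subsetP=> x /P1P[y /sLN' /memN].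
  have hg1 : fs_hom F P1 P2 g.
    apply: fs_corestr (fs_res hg sP1N) _ (fs_obj hf2).1.
    apply/subsetP=> _ /imsetP[x /P1P[y Lxy] ->].
    have : (g x, y) \in (h @* L)%G by apply/(mem_h L _ _ sLN); exists x.
    by rewrite Lf2 => /andP[].
  apply: (fs_graphI (fs_comp hg1 hf2)) => -[x y] /=.
  have LE z : (x, z) \in L -> z = f2 (g x).
    move=> Lxz; have : (g x, z) \in (h @* L)%G by apply/(mem_h L _ _ sLN); exists x.
    by rewrite Lf2 => /andP[_ /eqP].
  apply/idP/andP=> [Lxy | [/P1P[z Lxz] /eqP->]]; last by rewrite -(LE z).
  by rewrite -(LE y) //; split=> //; apply/P1P; exists y.
have sP1N : P1 \subset N.
  apply/subsetP=> x P1x; apply: (memN (x, f1 x)); apply: sLN'.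
  by rewrite Lf1 /= P1x eqxx.
have [P2 defP2 hg2] := fs_onto (fs_res hg sP1N).
have [k hk [gK kK]] := fs_inverse hg2 defP2.
apply: (fs_graphI (fs_comp hk hf1)) => -[x y] /=.
apply/(mem_h L _ _ sLN)/andP=> [[a La ->] | [P2x /eqP->]].
  move: La; rewrite Lf1 => /andP[/= P1a /eqP->].
  by rewrite gK // eqxx (fs_mem hg2).
by exists (k x); rewrite ?kK // Lf1 /= eqxx (fs_mem hk).
Qed.

Definition top_graph K := fs_graph K && (#|K| == #|S|).

Lemma top_graphP K : top_graph K -> exists2 a, a \in Aut_fs F S &
  forall z, (z \in K) = (z.1 \in S) && (z.2 == (a : {perm gT}) z.1).
Proof.
case/andP=> hK /eqP oK; have [P [f hf Kf]] := fs_graphP hK.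
have [sPS _] := fs_obj hf.
have oP : #|P| = #|S|.
  have -> : #|P| = #|[set (x, f x) | x in P]| by rewrite card_imset // => x y [].
  rewrite -oK; apply: eq_card => -[x y]; rewrite Kf /=.
  apply/imsetP/andP=> [[u Pu [-> ->]] | [Px /eqP->]]; last by exists x.
  by rewrite Pu eqxx.
have PS : P = S by apply/val_inj/eqP; rewrite eqEcard sPS /= oP leqnn.
rewrite PS in hf Kf; have [a Aa aE] := Aut_fs_of_hom hf.
by exists a => // -[x y]; rewrite Kf /=; case: (boolP (x \in S)) => // Sx; rewrite aE.
Qed.

(** For K the graph of an automorphism a of S, the pair (x, y) normalizes K exactly when y lies in
    a(x) Z(S); so the normalizer has order |S| |Z(S)|. *)
Lemma index_norm_top_graph K : top_graph K -> #|'N_G(K) : K| = #|'Z(S)|.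
Proof.
move=> tK; have [a /Aut_fsP[Aa ha] Ka] := top_graphP tK.
case/andP: tK => /fs_graph_sub sKG /eqP oK.
have sKN : K \subset 'N_G(K) by rewrite subsetI sKG normG.
apply/eqP; rewrite -(eqn_pmul2l (cardG_gt0 K)) Lagrange // oK -cardsX.
pose e (z : gT * gT) := (z.1, (a : {perm gT}) z.1 * z.2).
have einj : injective e by move=> [x c] [y d] [-> /mulgI->].
rewrite -(card_imset (mem (setX S 'Z(S))) einj); apply/eqP/eq_card => -[x y].
have aJ : {in S &, {morph a : u v / u ^ v}}.
  by move=> u v Su Sv; rewrite (fs_morphJ ha).
have aS u : u \in S -> (a : {perm gT}) u \in S by exact: fs_mem ha.
apply/idP/imsetP=> [/setIP[/setXP[/= Sx Sy] nKxy] | [[u c] /setXP[/= Su Zc] [-> ->]]].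
  exists (x, (a x)^-1 * y); last by rewrite /e /= mulKVg.
  rewrite inE /= Sx inE groupM ?groupV ?aS //=.
  apply/centP=> v Sv; apply/commute_sym/commgP/conjg_fixP.
  have [u Su ->] : exists2 u, u \in S & v = a u.
    have : v \in [set a u | u in S].
      suff -> : [set a u | u in S] = S by [].
      apply/eqP; rewrite eqEcard card_imset ?leqnn ?andbT; last exact: perm_inj.
      by case: (fs_inj ha).
    by case/imsetP=> u; exists u.
  have Ku : (u ^ x^-1, a (u ^ x^-1)) \in K by rewrite Ka /= eqxx groupJ ?groupV.
  have : (u ^ x^-1, a (u ^ x^-1)) ^ (x, y) \in K by rewrite memJ_norm.
  rewrite Ka => /andP[_].
  rewrite -[(_ ^ _).1]/((u ^ x^-1) ^ x) -[(_ ^ _).2]/(a (u ^ x^-1) ^ y) conjgKV.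
  by move/eqP=> {2}<-; rewrite conjgM -(fs_morphV ha) // -aJ ?groupV.
have /setIP[Sc cS] := Zc.
rewrite /e /= !inE /= Su groupM ?aS //=.
apply/subsetP=> _ /imsetP[[v w] Kvw ->]; move: Kvw; rewrite Ka /= => /andP[Sv /eqP->].
suffices: (v ^ u, a v ^ (a u * c)) \in K by [].
by rewrite Ka /= groupJ //= conjgM -aJ // /conjg -(centP cS _ (aS _ (groupJ Sv Su))) mulKg.
Qed.

Lemma card_top_graphs : #|[set K | top_graph K]| = #|Aut_fs F S|.
Proof.
have gr (a : {perm gT}) : a \in Aut_fs F S -> group_set [set (x, a x) | x in S].
  case/Aut_fsP=> _ ha.
  apply/group_setP; split=> [|_ _ /imsetP[x Rx ->] /imsetP[y Ry ->]].
    by apply/imsetP; exists 1; rewrite ?group1 ?(fs_morph1 ha).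
  by apply/imsetP; exists (x * y); rewrite ?groupM ?(fs_morphM ha).
pose e (a : {perm gT}) := <<[set (x, a x) | x in S]>>%G.
have eE a z : a \in Aut_fs F S -> (z \in e a) = (z.1 \in S) && (z.2 == a z.1).
  move=> Aa; rewrite /= (gen_set_id (gr a Aa)); case: z => x y /=.
  apply/imsetP/andP=> [[u Pu [-> ->]] | [Px /eqP->]]; last by exists x.
  by rewrite Pu eqxx.
have inje : {in Aut_fs F S &, injective e}.
  move=> a b Aa Ab eab; have /Aut_fsP[AutSa _] := Aa; have /Aut_fsP[AutSb _] := Ab.
  apply: (eq_Aut AutSa AutSb) => x Sx.
  have : (x, a x) \in e a by rewrite eE //= Sx eqxx.
  by rewrite eab eE // => /andP[_ /eqP].
rewrite -(card_in_imset inje); apply: eq_card => K; rewrite inE.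
apply/idP/imsetP=> [tK | [a Aa ->]].
  have [a Aa Ka] := top_graphP tK; exists a => //.
  by apply/val_inj/setP=> z; rewrite Ka eE.
have /Aut_fsP[_ ha] := Aa; apply/andP; split.
  by apply: (fs_graphI ha) => z; rewrite eE.
by rewrite /= (gen_set_id (gr a Aa)) card_imset // => x y [].
Qed.

(** Here m is the order of Out_F(S), prime to p because S is fully normalized and so Inn(S) is a
    Sylow subgroup of Aut_F(S). *)
Lemma card_Aut_fs_top :
  exists2 m, (#|Aut_fs F S| * #|'Z(S)| = #|S| * m)%N & p^'.-nat m.
Proof.
have nS : fully_normalized F S.
  move=> f hf; suff -> : f @: S = S by [].
  apply/eqP; rewrite eqEcard card_in_imset ?leqnn ?andbT.
    by case: (fs_inj hf).
  exact: fs_injective hf.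
have [_ /and3P[sUA _ p'm]] := satF.1 S (subxx S) nS.
exists #|Aut_fs F S : Aut_conj S S|; last exact: p'm.
have oA := Lagrange (G := Group (Aut_fs_group_set F (subxx S)))
  (H := (conj_aut S @* 'N_S(S))%G) sUA.
rewrite -[#|Aut_fs F S|]oA mulnAC; congr (_ * _)%N.
rewrite /= (setIidPl (normG S)) card_morphim ker_conj_aut (setIidPr (normG S)).
by rewrite -indexgI mulnC (Lagrange (subsetIl S 'C(S))).
Qed.

End Graphs.

Section Characteristic.

Variables (p : nat) (gT : finGroupType) (S : {group gT}) (F : fusion_system S).
Implicit Types (P Q R : {group gT}) (K L H : {group gT * gT}).
Hypotheses (pS : p.-group S) (satF : saturated F p).

Local Notation G := (setX_group S S).
Local Notation fs_graph := (fs_graph F).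
Local Notation top_graph := (top_graph F).

Lemma card_fs_graph K : fs_graph K -> #|K| <= #|S|.
Proof.
move=> hK; rewrite -(card_proj2 hK) subset_leq_card //.
apply/subsetP=> y /mem_proj2[x Kxy]; have := subsetP (fs_graph_sub hK) _ Kxy.
by rewrite inE => /andP[].
Qed.

(** A coset H x is fixed by exactly one top graph, namely H^x, and there are |S| cosets. *)
Lemma sum_fixc_top H : top_graph H -> (\sum_(K | top_graph K) fixc G H K)%N = #|S|.
Proof.
move=> tH; have /andP[hH /eqP oH] := tH.
have fixE K : fixc G H K = (\sum_(C in rcosets H G | C \in 'Fix_('Rs)(K)) 1)%N.
  by rewrite sum1_card; apply: eq_card => C; rewrite inE.
under eq_bigr => K _ do rewrite fixE.
rewrite (exchange_big_dep (fun C => C \in rcosets H G)) /=; last by move=> K C _ /andP[].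
have sHG := fs_graph_sub hH.
have -> : #|S| = #|rcosets H G|.
  by apply/eqP; rewrite -(eqn_pmul2l (cardG_gt0 H)) (Lagrange sHG) cardsX oH.
rewrite -sum1_card; apply: eq_bigr => C /rcosetsP[x Gx ->].
rewrite (big_pred1 (H :^ x)%G) // => K.
rewrite sub_afixRs_norms; apply/idP/eqP=> [/and3P[/andP[_ /eqP oK] _ sKHx] | ->].
  by apply/val_inj/eqP; rewrite eqEcard sKHx /= cardJg oK oH leqnn.
rewrite subxx andbT; apply/andP; split; last by apply/rcosetsP; exists x.
by apply/andP; rewrite fs_graphJ //= cardJg oH.
Qed.

Lemma fixc_top0 H K : fs_graph H -> ~~ top_graph H -> top_graph K -> fixc G H K = 0%N.
Proof.
move=> hH ntH /andP[hK /eqP oK]; apply: contraNeq ntH => fHK.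
have [g Gg sKH] := fixc_conj (fs_graph_sub hK) fHK.
rewrite /top_graph hH eqn_leq card_fs_graph //= -oK -(cardJg H g).
exact: subset_leq_card.
Qed.

Lemma sum_mark_top (w : {group gT * gT} -> int) : supported fs_graph w ->
  (\sum_(K | top_graph K) mark G w K = (\sum_(H | top_graph H) w H) * #|S|%:R)%R.
Proof.
move=> sw; rewrite exchange_big /= mulr_suml.
rewrite (bigID top_graph) /= addrC big1 => [|H /andP[_ ntH]]; last first.
  apply: big1 => K tK; have [->|/sw hH] := eqVneq (w H) 0%R; first by rewrite mul0r.
  by rewrite fixc_top0 // mulr0.
rewrite add0r; apply: eq_big => [H|H /andP[_ tH]].
  by apply: andb_idl => /andP[/fs_graph_sub].
by rewrite -mulr_sumr -natr_sum sum_fixc_top.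
Qed.

(* The analogue of the characteristic biset of Broto, Levi and Oliver: the orbits
   of [S x S] with multiplicities [w] form a virtual (S,S)-biset which is stable
   under [F] on the left and whose degree is prime to [p]. *)
Lemma exists_characteristic : prime p -> exists w : {group gT * gT} -> int,
  [/\ supported fs_graph w,
    forall K L, fs_graph K -> fs_graph L ->
      graph_class S K = graph_class S L -> mark G w K = mark G w L
    & ~~ (p %| (\sum_(H | top_graph H) w H)%R)%Z].
Proof.
move=> p_pr.
have /fin_all_exists[star starP] : forall R, exists K : {group gT * gT},
    R \subset S -> receptive_graph F R K.
  move=> R; have [sRS | _] := boolP (R \subset S); last by exists 1%G.
  by have [K KR] := exists_receptive_graph pS satF sRS; exists K.
have lift := receptive_graph_lift satF starP.
have cJ K g : g \in G -> fs_graph K -> graph_class S (K :^ g)%G = graph_class S K.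
  by move=> Gg _; apply: graph_classJ.
have c_card K L : fs_graph K -> fs_graph L -> graph_class S K = graph_class S L ->
    #|K| = #|L|.
  by move=> hK hL cKL; rewrite -(card_graph_class hK) cKL (card_graph_class hL).
have graphJ K g : g \in G -> fs_graph K -> fs_graph (K :^ g)%G by apply: fs_graphJ.
have mark0 K : mark G (fun _ => 0%R) K = 0%R by apply: big1 => H _; rewrite mul0r.
have sw00 : supported fs_graph (fun _ => 0%R) by move=> H; rewrite eqxx.
(* |Z(S)| is the index of every top graph in its normalizer, hence the least positive value that all
   top graphs can share as mark. *)
have div0 K : fs_graph K -> #|K| = #|S| ->
    (#|'N_G(K) : K| %| (#|'Z(S)|%:R - mark G (fun _ => 0%R) K)%R)%Z.
  move=> hK oK; rewrite mark0 subr0 (index_norm_top_graph (F := F)) ?natz //.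
  by apply/andP; rewrite hK oK.
have [w0 [sw0 m0 _]] := mark_adjust (@fs_graph_sub _ _ F) graphJ sw00
  (fun K g _ _ _ => erefl (#|'Z(S)|%:R)%R) div0.
have st0 : stable_above G fs_graph (graph_class S) #|S|.-1 w0.
  move=> K L hK hL cKL; rewrite prednK ?cardG_gt0 // => leSK.
  have oK : #|K| = #|S| by apply/eqP; rewrite eqn_leq leSK card_fs_graph.
  by rewrite !m0 // -(c_card K L).
have [w [sw stw Mw]] := exists_stable (@fs_graph_sub _ _ F) graphJ
  (@fs_graphS _ _ F) cJ c_card lift sw0 st0.
exists w; split=> // [K L hK hL cKL|]; first exact: stw.
(* The marks of the top graphs add up to |S| times their total weight, and also to |Aut_F(S)| |Z(S)|
   = |S| |Out_F(S)|. So the total weight is |Out_F(S)|. *)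
have := sum_mark_top sw; rewrite (eq_bigr (fun _ => #|'Z(S)|%:R)%R); last first.
  move=> K /andP[hK /eqP oK]; rewrite Mw ?m0 //.
  by rewrite oK prednK ?cardG_gt0.
have -> : (\sum_(K | top_graph K) #|'Z(S)|%:R = (#|Aut_fs F S| * #|'Z(S)|)%N%:R :> int)%R.
  rewrite sumr_const -card_top_graphs natrM mulr_natl; congr (_ *+ _)%R.
  by apply: eq_card => K; rewrite inE.
have [m -> p'm] := card_Aut_fs_top satF.
rewrite natrM mulrC => /mulIf<-; last by rewrite pnatr_eq0 -lt0n cardG_gt0.
by rewrite natz /dvdz /= -p'natE.
Qed.

End Characteristic.

(** * Transfer of homomorphisms to F_p *)

Section CycleIndex.

Variables (gT : finGroupType) (S P : {group gT}).
Hypothesis sPS : P \subset S.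
Implicit Types t u : gT.

Lemma astab_rcoset u : 'C[P :* u | 'Rs] = P :^ u.
Proof.
apply/setP=> x; apply/astab1P/idP => [| Px].
  move/afix1P; rewrite -afix_cycle sub_afixRs_norms cycle_subG; exact.
by apply/afix1P; rewrite -afix_cycle sub_afixRs_norms cycle_subG.
Qed.

Lemma index_rcoset_cycle t u : #|<[t]> : P :* u| = #|<[t]> : P :^ u|.
Proof.
by rewrite -[LHS]/#|orbit 'Rs <[t]> (P :* u)| card_orbit astab_rcoset indexgI.
Qed.

(** Both sides say that t^l fixes the coset P u. *)
Lemma expg_mem_conj t u l :
  ((t ^+ l) ^ u^-1 \in P) = (#|<[t]> : P :* u| %| l).
Proof.
rewrite -mem_conjg index_rcoset_cycle -indexgI.
set C := _ :&: _; have sCt : C \subset <[t]> by apply: subsetIl.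
have nCt : <[t]> \subset 'N(C) by apply: sub_abelian_norm (cycle_abelian t) sCt.
have nt : t \in 'N(C) by rewrite -cycle_subG.
rewrite -card_quotient // quotient_cycle // -orderE order_dvdn.
rewrite -morphX //; apply/idP/eqP=> [Pt | /coset_idr Ct].
  by apply: coset_id; rewrite inE mem_cycle.
by have /setIP[] := Ct (groupX _ nt).
Qed.

Lemma card_rcoset_cycle t u :
  u \in S -> t \in S -> #|P :* u * <[t]>| = (#|P| * #|<[t]> : P :* u|)%N.
Proof.
move=> Su St; rewrite index_rcoset_cycle.
have <- : #|P :^ u * <[t]>| = #|P :* u * <[t]>|.
  by rewrite conjsgE -mulgA card_lcoset.
apply/eqP; rewrite -(eqn_pmul2r (cardG_gt0 (P :^ u :&: <[t]>)%G)) /= -mul_cardG.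
rewrite cardJg -mulnA; apply/eqP; congr (_ * _)%N.
by rewrite mulnC setIC -(indexgI <[t]>%G (P :^ u)%G) Lagrange ?subsetIl.
Qed.

(* [t ^+ n] with [n = #|<[t]> : P :* u|] is the first power of [t] fixing the
   coset [P :* u]; the double coset [P u <[t]>] is an orbit of [t]. *)
Section Orbits.

Variables (t : gT) (X : {set gT}).
Hypotheses (St : t \in S) (trX : is_transversal X (rcosets P S :* <[t]>) S).

Lemma card_double_coset_stable (Q : pred gT) n :
    (forall x y, x \in S -> y \in P :* x * <[t]> -> Q y = Q x) ->
    (forall x, x \in S -> Q x -> #|<[t]> : P :* x| = n) ->
  #|[set u in S | Q u]| = (#|P| * n * #|[set x in X | Q x]|)%N.
Proof.
move=> Qst Qn; have partS := rcosets_cycle_partition sPS St.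
have sXS : {subset X <= S} by apply/subsetP/(transversal_sub trX).
have pbE x : x \in X -> pblock (rcosets P S :* <[t]>) x = P :* x * <[t]>.
  move=> Xx; have [/eqP tiP _ _] := and3P partS.
  apply: def_pblock; first by case/and3P: partS.
    by rewrite mem_mulg ?set11 // -rcosetE imset_f ?sXS.
  by rewrite -[x in x \in _]mulg1 mem_mulg ?rcoset_refl ?group1.
rewrite -sum1_card (eq_bigl (fun u => (u \in S) && Q u)) => [|u]; last by rewrite inE.
rewrite big_mkcondr (set_partition_big _ partS) /= -(pblock_transversal trX).
rewrite big_imset /=; last exact: pblock_inj trX.
rewrite (eq_bigr (fun x => if Q x then (#|P| * n)%N else 0%N)) => [|x Xx].
  rewrite -big_mkcondr sum_nat_const mulnC; congr (_ * _)%N.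
  by apply: eq_card => x; rewrite inE.
have Sx := sXS x Xx; rewrite pbE //.
rewrite (eq_bigr (fun _ => if Q x then 1 else 0)%N) => [|y Bxy]; last by rewrite (Qst x).
rewrite sum_nat_const card_rcoset_cycle //; case: ifP => [Qx | _]; last by rewrite muln0.
by rewrite (Qn x Sx Qx) muln1.
Qed.

End Orbits.

Lemma transfer_additive p (c : gT -> 'F_p) :
    {in P &, {morph c : x y / x * y >-> (x + y)%R}} ->
  exists2 u : gT -> 'F_p, {in S &, {morph u : x y / x * y >-> (x + y)%R}} &
    forall t X, t \in S -> is_transversal X (rcosets P S :* <[t]>) S ->
      u t = (\sum_(x in X) c ((t ^+ #|<[t]> : P :* x|) ^ x^-1)%g)%R.
Proof.
move=> cM; pose al := Morphism (cM : {in P &, {morph c : x y / x * y >-> (x * y)}}).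
have abA : abelian (al @* P) by apply/centsP=> x _ y _; apply: addrC.
exists (fun t => FiniteModule.fmval (transfer S abA t)) => [x y Sx Sy | t X St trX].
  by rewrite transferM.
rewrite (transfer_cycle_expansion sPS abA St trX) FiniteModule.fmval_sum.
apply: eq_bigr => x Xx; have trX' := expg_mem_conj t x #|<[t]> : P :* x|.
rewrite dvdnn in trX'; rewrite /= FiniteModule.fmodK //.
exact: (mem_morphim al trX' trX').
Qed.

End CycleIndex.

(** * Fixed points and orbits of t on cosets, counted by value *)

Section OrbitCount.

Variables (p : nat) (gT : finGroupType) (S T P : {group gT}) (v : gT -> 'F_p).
Hypotheses (sPS : P \subset S) (nTS : S \subset 'N(T)) (sTS : T \subset S).
Hypothesis vJ : forall y b, y \in P -> y \in T -> b \in P -> v (y ^ b) = v y.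
Hypothesis vX : forall y k, y \in P -> y \in T -> v (y ^+ k) = (v y *+ k)%R.

(** Elements u are counted instead of cosets, so each coset has weight |P|; in this form the count
    compares with marks without a transversal. *)
Definition fix_count t a : nat :=
  #|[set u in S | (t ^ u^-1 \in P) && (v (t ^ u^-1) == a)]|.

Definition orbit_count t l a : nat :=
  #|[set u in S | (#|<[t]> : P :* u| == l) && (v ((t ^+ l) ^ u^-1) == a)]|.

Definition orbit_num (X : {set gT}) t l a : nat :=
  #|[set x in X | (#|<[t]> : P :* x| == l) && (v ((t ^+ l) ^ x^-1) == a)]|.

(** t^l fixes P u exactly when the orbit length n divides l, and the value at t^l is then l / n
    times the value at t^n. *)
Lemma fix_countX t l a : t \in T -> 0 < l ->
  fix_count (t ^+ l) a = (\sum_(z : 'I_l.+1 * 'F_p |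
    (z.1 %| l) && (z.2 *+ (l %/ z.1) == a)%R) orbit_count t z.1 z.2)%N.
Proof.
move=> Tt l_gt0; rewrite /fix_count -sum1_card.
pose n u := #|<[t]> : P :* u|.
have main u : u \in S -> n u %| l ->
    v ((t ^+ l) ^ u^-1) = (v ((t ^+ n u) ^ u^-1) *+ (l %/ n u))%R.
  move=> Su dvl; have Py : (t ^+ n u) ^ u^-1 \in P by rewrite expg_mem_conj.
  have Ty : (t ^+ n u) ^ u^-1 \in T.
    by rewrite memJ_norm ?groupX // groupV (subsetP nTS).
  by rewrite -(vX _ Py Ty) -conjXg -expgM mulnC divnK.
rewrite (partition_big (fun u => (inord (n u) : 'I_l.+1, v ((t ^+ n u) ^ u^-1)))
  (fun z : 'I_l.+1 * 'F_p => (z.1 %| l) && (z.2 *+ (l %/ z.1) == a)%R)) /=.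
  apply: eq_bigr => -[m b] /= /andP[dvm /eqP ab]; rewrite /orbit_count -sum1_card.
  apply: eq_bigl => u; rewrite !inE expg_mem_conj // -/(n u).
  case Su: (u \in S) => //=; apply/andP/andP=> [[/andP[dvn _]] | [/eqP nm /eqP vb]].
    have ltn : n u < l.+1 by rewrite ltnS dvdn_leq.
    by move=> /eqP[/(congr1 val)/= <- <-]; rewrite inordK // !eqxx.
  have dvn : n u %| l by rewrite nm.
  rewrite dvn main // nm vb ab eqxx; split=> //; apply/eqP; congr (_, _).
  by apply: val_inj; rewrite /= inordK.
move=> u; rewrite inE expg_mem_conj // -/(n u) => /and3P[Su dvn /eqP va].
have ltn : n u < l.+1 by rewrite ltnS dvdn_leq.
by rewrite inordK // dvn -main // va eqxx.
Qed.

Variables (t : gT) (X : {set gT}).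
Hypotheses (Tt : t \in T) (trX : is_transversal X (rcosets P S :* <[t]>) S).

Let St : t \in S := subsetP sTS t Tt.

Lemma orbit_countE l a : orbit_count t l a = (#|P| * l * orbit_num X t l a)%N.
Proof.
apply: (card_double_coset_stable sPS St trX) => [x y Sx|x Sx /andP[/eqP]//].
case/mulsgP=> _ _ /rcosetP[b Pb ->] /cycleP[i ->] {y}->.
have Sb := subsetP sPS b Pb.
have -> : #|<[t]> : P :* (b * x * t ^+ i)| = #|<[t]> : P :* x|.
  rewrite !index_rcoset_cycle -mulgA !conjsgM (conjGid Pb).
  by rewrite -{1}(conjGid (mem_cycle t i)) indexJg.
case: eqP => //= nl.
have Py : (t ^+ l) ^ x^-1 \in P by rewrite expg_mem_conj // nl.
have Ty : (t ^+ l) ^ x^-1 \in T.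
  by rewrite memJ_norm ?groupX // groupV (subsetP nTS).
have -> : (t ^+ l) ^ (b * x * t ^+ i)^-1 = ((t ^+ l) ^ x^-1) ^ b^-1.
  rewrite !invMg !conjgM; congr ((_ ^ _) ^ _).
  by apply/conjg_fixP/commgP/commuteV/commuteX2.
by rewrite vJ ?groupV.
Qed.

(** The bound |gT| on orbit lengths depends neither on P nor on t, so the sums for all P and t share
    one index set. *)
Lemma sum_orbit_num :
  (\sum_(x in X) v ((t ^+ #|<[t]> : P :* x|) ^ x^-1)%g =
   \sum_(z : 'I_#|gT|.+1 * 'F_p) (orbit_num X t z.1 z.2)%:R * z.2)%R.
Proof.
pose n u := #|<[t]> : P :* u|.
have ltn u : n u < #|gT|.+1.
  rewrite ltnS; apply: leq_trans (max_card (mem <[t]>)).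
  by rewrite /n index_rcoset_cycle dvdn_leq ?cardG_gt0 ?dvdn_indexg.
rewrite (partition_big (fun x => (inord (n x) : 'I_#|gT|.+1, v ((t ^+ n x) ^ x^-1)))
  xpredT) //=.
apply: eq_bigr => -[l a] _ /=; rewrite mulr_natl -sumr_const.
rewrite (eq_bigl (fun x => x \in [set x in X | (n x == l) && (v ((t ^+ l) ^ x^-1) == a)])).
  by apply: eq_bigr => x /setIdP[_ /andP[/eqP nl /eqP<-]]; rewrite -nl.
move=> x /=; rewrite inE; congr (_ && _).
apply/eqP/andP=> [[/(congr1 val)/= <- <-] | [/eqP nl /eqP va]].
  by rewrite inordK.
by congr (_, _); [apply: val_inj; rewrite /= inordK | rewrite nl].
Qed.

End OrbitCount.

Lemma fixc_card (gT : finGroupType) (G H : {group gT}) (K : {set gT}) :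
  H \subset G -> (fixc G H K * #|H|)%N = #|[set z in G | K \subset H :^ z]|.
Proof.
move=> sHG; rewrite -[RHS]sum1_card (eq_bigl (fun z => (z \in G) && (K \subset H :^ z))).
  rewrite big_mkcondr (set_partition_big _ (rcosets_partition sHG)) /=.
  rewrite (eq_bigr (fun C => if C \in 'Fix_('Rs)(K) then #|H| else 0%N)).
    by rewrite -big_mkcondr sum_nat_const; congr (_ * _)%N; apply: eq_card => C; rewrite inE.
  move=> C /rcosetsP[x Gx ->].
  rewrite (eq_bigr (fun _ => if H :* x \in 'Fix_('Rs)(K) then 1 else 0)%N).
    by rewrite sum_nat_const card_rcoset; case: ifP => _; rewrite ?muln1 ?muln0.
  by move=> z /rcoset_eqP <-; rewrite sub_afixRs_norms.
by move=> z; rewrite inE.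
Qed.

Lemma expg_pair (gT1 gT2 : finGroupType) (x : gT1) (y : gT2) n :
  (x, y) ^+ n = (x ^+ n, y ^+ n).
Proof. by elim: n => // n IHn; rewrite !expgS IHn. Qed.

Section CycleGraphs.

Variables (gT : finGroupType) (S : {group gT}) (F : fusion_system S).

Lemma fs_graph_cycle t c : fs_graph F <[(t, c)]>%G <->
  exists2 g, fs_hom F <[t]>%G S g & g t = c.
Proof.
split=> [/fs_graphP[P [f hf Kf]] | [g hg gt]].
  have := cycle_id (t, c); rewrite Kf /= => /andP[Pt /eqP->]; exists f => //.
  by apply: fs_res hf _; rewrite cycle_subG.
apply: (fs_graphI hg) => -[x y] /=; apply/cycleP/andP=> [[i] | [/cycleP[i ->] /eqP->]].
  rewrite expg_pair => -[-> ->]; rewrite mem_cycle; split=> //.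
  by rewrite (fs_morphX _ hg) ?cycle_id // gt.
by exists i; rewrite expg_pair (fs_morphX _ hg) ?cycle_id // gt.
Qed.

Lemma fs_hom_cycle t chi : fs_hom F <[t]>%G S chi ->
  exists2 k, fs_hom F <[chi t]>%G S k & k (chi t) = t.
Proof.
move=> hchi; have [R defR hR] := fs_onto hchi.
have [k hk [ck _]] := fs_inverse hR defR.
have [stS _] := fs_obj hchi.
exists k; last by rewrite ck // cycle_id.
apply: fs_res (fs_comp hk (fs_incl F stS (subxx S))) _.
by rewrite cycle_subG defR imset_f ?cycle_id.
Qed.

Lemma fs_graph_cycle_hom t c chi : fs_hom F <[t]>%G S chi ->
  fs_graph F <[(t, c)]>%G -> fs_graph F <[(chi t, c)]>%G.
Proof.
move=> hchi /fs_graph_cycle[g hg gt]; have [k hk kt] := fs_hom_cycle hchi.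
apply/fs_graph_cycle; exists (g \o k); last by rewrite /= kt.
apply: fs_comp (fs_corestr hk _ _) hg; last by case: (fs_obj hchi).
apply/subsetP=> _ /imsetP[_ /cycleP[i ->] ->].
by rewrite (fs_morphX _ hk) ?cycle_id // kt mem_cycle.
Qed.

End CycleGraphs.

(** * Extension of an invariant homomorphism from h to S *)

Section ExtendHyperfocal.

Variables (p : nat) (gT : finGroupType) (S : {group gT}) (F : fusion_system S).
Hypotheses (p_pr : prime p) (pS : p.-group S) (satF : saturated F p).

Let T : {group gT} := [group of hyperfocal p F].
Let sTS : T \subset S := hyperfocal_sub p F.
Let nTS : S \subset 'N(T) := hyperfocal_norm p F.
Local Notation pi := (coset T).

Lemma fs_hyperfocal (P : {group gT}) f y :
  fs_hom F P S f -> y \in P -> y \in T -> f y \in T.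
Proof.
move=> hf Py Ty; have [s Ss fE] := fs_inner_mod pS satF hf.
apply: coset_idr; first by apply: (subsetP nTS); apply: (fs_mem hf).
by rewrite fE // coset_id // memJ_norm // (subsetP nTS).
Qed.

Variable gam : gT -> 'F_p.
Hypothesis gam1 : gam 1 = 0%R.
(** The coboundary of [gam] is inflated from S/h. This makes [gam] an S-invariant homomorphism on
    h. *)
Hypothesis gam_descends : forall x x' y y', x \in S -> x' \in S -> y \in S -> y' \in S ->
  pi x = pi x' -> pi y = pi y' ->
  (gam x + gam y - gam (x * y)%g = gam x' + gam y' - gam (x' * y')%g)%R.

Lemma gamMr x t : x \in S -> t \in T -> gam (x * t) = (gam x + gam t)%R.
Proof.
move=> Sx Tt; have St := subsetP sTS t Tt.
have := gam_descends Sx Sx St (group1 S) erefl.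
rewrite coset_id // coset_id ?group1 // mulg1 gam1 addr0 subrr.
by move/(_ erefl)/eqP; rewrite subr_eq0 => /eqP.
Qed.

Lemma gamMl x t : x \in S -> t \in T -> gam (t * x) = (gam t + gam x)%R.
Proof.
move=> Sx Tt; have St := subsetP sTS t Tt.
have := gam_descends St (group1 S) Sx Sx _ erefl.
rewrite coset_id // coset_id ?group1 // mul1g gam1 add0r subrr.
by move/(_ erefl)/eqP; rewrite subr_eq0 => /eqP.
Qed.

Lemma gamJ t s : t \in T -> s \in S -> gam (t ^ s) = gam t.
Proof.
move=> Tt Ss; have Tts : t ^ s \in T by rewrite memJ_norm // (subsetP nTS).
by apply: (addrI (gam s)); rewrite -gamMr // -conjgC gamMl // addrC.
Qed.

Lemma gamX t k : t \in T -> gam (t ^+ k) = (gam t *+ k)%R.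
Proof.
move=> Tt; elim: k => [|k IHk]; first by rewrite expg0 gam1.
by rewrite expgS gamMl ?groupX ?(subsetP sTS) // IHk mulrS.
Qed.

Section Hom.

Variables (P : {group gT}) (f : gT -> gT).
Hypothesis hf : fs_hom F P S f.

Let sPS : P \subset S := (fs_obj hf).1.

Lemma gam_fsJ y b : y \in P -> y \in T -> b \in P -> gam (f (y ^ b)) = gam (f y).
Proof.
by move=> Py Ty Pb; rewrite (fs_morphJ hf) // gamJ ?(fs_mem hf) // (fs_hyperfocal hf).
Qed.

Lemma gam_fsX y k : y \in P -> y \in T -> gam (f (y ^+ k)) = (gam (f y) *+ k)%R.
Proof. by move=> Py Ty; rewrite (fs_morphX _ hf) // gamX // (fs_hyperfocal hf). Qed.

(** u is the transfer of [gam (f x) - gam (x ^ s)], which is additive because both terms have the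
    same coboundary. At t in h, invariance turns the second terms into [gam t] times the sum of the
    orbit lengths, which is |S : P|. *)
Lemma fs_transfer : exists2 u : gT -> 'F_p,
  {in S &, {morph u : x y / x * y >-> (x + y)%R}} &
  forall t X, t \in T -> is_transversal X (rcosets P S :* <[t]>) S ->
    (u t = \sum_(x in X) gam (f ((t ^+ #|<[t]> : P :* x|) ^ x^-1)%g)
             - gam t *+ #|S : P|)%R.
Proof.
have [s Ss fE] := fs_inner_mod pS satF hf.
pose c x := (gam (f x) - gam (x ^ s))%R.
have cM : {in P &, {morph c : x y / x * y >-> (x + y)%R}}.
  move=> x y Px Py; have [Sx Sy] := (subsetP sPS x Px, subsetP sPS y Py).
  have := gam_descends (fs_mem hf Px) (groupJ Sx Ss) (fs_mem hf Py) (groupJ Sy Ss)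
    (fE x Px) (fE y Py).
  rewrite -(fs_morphM hf) // -conjMg => eqd; rewrite /c.
  rewrite -[gam (f (x * y))](subKr (gam (f x) + gam (f y))) eqd; ring.
have [u uM uE] := transfer_additive sPS cM; exists u => // t X Tt trX.
have St := subsetP sTS t Tt.
rewrite (uE _ _ St trX) -(sum_index_rcosets_cycle sPS St trX) -sumrMnr -sumrB.
apply: eq_bigr => x Xx; rewrite /c; congr (_ - _)%R.
have Sx : x \in S by apply: (subsetP (transversal_sub trX)).
rewrite gamJ //; first by rewrite gamJ ?groupV ?groupX // gamX.
by rewrite memJ_norm ?groupX // groupV (subsetP nTS).
Qed.

End Hom.

Local Notation G := (setX_group S S).

(** Both sides count the triples u, v, c with (t, c) in H^(u, v). Given u and v, the only candidate
    is c = f(t^(u^-1))^v, whose value under [gam] is the same for all v; whence the factor |S|. *)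
Lemma fix_count_mark (P : {group gT}) f (H : {group gT * gT}) t a :
    fs_hom F P S f -> (forall z, (z \in H) = (z.1 \in P) && (z.2 == f z.1)) ->
    H \subset G -> t \in T ->
  ((\sum_(c in T | gam c == a) fixc G H <[(t, c)]>) * #|H| =
     #|S| * fix_count S P (gam \o f) t a)%N.
Proof.
move=> hf Hf sHG Tt; have [sPS _] := fs_obj hf.
have inH u v c : ((t, c) \in H :^ (u, v)) =
    (t ^ u^-1 \in P) && (c == f (t ^ u^-1) ^ v).
  rewrite mem_conjg Hf -[((t, c) ^ _).1]/(t ^ u^-1) -[((t, c) ^ _).2]/(c ^ v^-1).
  by rewrite -[in RHS](inj_eq (conjg_inj v^-1)) conjgK.
rewrite big_distrl /=.
rewrite (eq_bigr (fun c => \sum_(u in S) \sum_(v in S) ((t, c) \in H :^ (u, v)))%N); last first.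
  move=> c _; rewrite fixc_card // pair_big_dep /= -sum1_card.
  rewrite (eq_bigl (fun z => (z \in G) && ((t, c) \in H :^ z))); last first.
    by move=> z; rewrite inE cycle_subG.
  rewrite big_mkcondr /= (eq_bigl (fun z => (z.1 \in S) && (z.2 \in S))).
    by apply: eq_bigr => -[u v] _ /=; case: (_ \in _).
  by move=> [u v]; rewrite inE.
rewrite exchange_big /= /fix_count -sum1_card.
rewrite (eq_bigl (fun u => (u \in S) &&
   ((t ^ u^-1 \in P) && (gam (f (t ^ u^-1)) == a)))) => [|u]; last by rewrite inE.
rewrite big_mkcondr big_distrr /=; apply: eq_bigr => u Su.
rewrite exchange_big /=.
pose b := (t ^ u^-1 \in P) && (gam (f (t ^ u^-1)) == a).
transitivity (\sum_(v in S) b)%N; rewrite {}/b.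
  apply: eq_bigr => v Sv; under eq_bigr => c _ do rewrite inH.
  have [Pt | nPt] /= := boolP (t ^ u^-1 \in P); last by rewrite big1.
  have Tf : f (t ^ u^-1) \in T.
    by rewrite (fs_hyperfocal hf) // memJ_norm // groupV (subsetP nTS).
  have gf : gam (f (t ^ u^-1) ^ v) = gam (f (t ^ u^-1)) by rewrite gamJ.
  have [ga | nga] := boolP (gam (f (t ^ u^-1)) == a).
    rewrite (bigD1 (f (t ^ u^-1) ^ v)) /=; last first.
      by rewrite gf ga andbT memJ_norm // (subsetP nTS).
    by rewrite eqxx big1 // => c /andP[_ /negbTE->].
  rewrite big1 // => c /andP[_ /eqP gca]; apply/eqP; rewrite eqb0.
  by apply: contra nga => /eqP cf; rewrite -gca cf gf.
by rewrite sum_nat_const; case: (_ && _); rewrite ?muln1 ?muln0.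
Qed.

(** * F-stability of the trace *)

Section Stable.

Variables (w : {group gT * gT} -> int).
Variables (P : {group gT * gT} -> {group gT}) (f : {group gT * gT} -> gT -> gT).
Hypothesis sw : supported (fs_graph F) w.
Hypothesis stw : forall K L, fs_graph F K -> fs_graph F L ->
  graph_class S K = graph_class S L -> mark G w K = mark G w L.
Hypothesis hf : forall H, fs_hom F (P H) S (f H).
Hypothesis Hf : forall H, fs_graph F H ->
  forall z, (z \in H) = (z.1 \in P H) && (z.2 == f H z.1).

Let sPS H : P H \subset S := (fs_obj (hf H)).1.

Let v H := gam \o f H.

Lemma card_graph_dom H : fs_graph F H -> #|H| = #|P H|.
Proof.
move=> hH; have -> : #|P H| = #|[set (x, f H x) | x in P H]|.
  by rewrite card_imset // => x y [].
apply: eq_card => -[x y]; rewrite Hf //=.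
apply/andP/imsetP=> [[Px /eqP->] | [u Pu [-> ->]]]; first by exists x.
by rewrite Pu eqxx.
Qed.

(** Both groups have second projection <c>, so as graphs they lie in one class. If one is not a
    graph, neither is the other, and both marks are 0. *)
Lemma mark_cycle_stable t c chi : c \in S -> fs_hom F <[t]>%G S chi ->
  mark G w <[(chi t, c)]> = mark G w <[(t, c)]>.
Proof.
move=> Sc hchi; have [k hk kt] := fs_hom_cycle hchi.
have sG u : fs_hom F <[u]>%G S id -> <[(u, c)]> \subset G.
  by case/fs_obj; rewrite !cycle_subG inE /= => ->.
have [stS _] := fs_obj hchi; have [scS _] := fs_obj hk.
have stG := sG t (fs_incl F stS (subxx S)).
have scG := sG (chi t) (fs_incl F scS (subxx S)).
have [hK | nhK] := boolP (fs_graph F <[(t, c)]>%G).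
  apply: (stw (K := <[(chi t, c)]>%G) (L := <[(t, c)]>%G)) => //.
    exact: fs_graph_cycle_hom hchi hK.
  rewrite /graph_class; congr (conj_rep S _); apply: val_inj.
  by rewrite /= !morphim_cycle ?inE.
have nhK' : ~~ fs_graph F <[(chi t, c)]>%G.
  by apply: contra nhK => /(fs_graph_cycle_hom hk); rewrite kt.
have graphJ K g : g \in G -> fs_graph F K -> fs_graph F (K :^ g)%G by apply: fs_graphJ.
by rewrite !(mark_unsupported graphJ (@fs_graphS _ _ F) _ sw).
Qed.

Local Open Scope ring_scope.

(** On the support of w the divisor |H| equals |P H|, so cosets are counted instead of elements. *)
Definition fix_total t a : rat :=
  \sum_H (w H)%:~R / #|H|%:R * (fix_count S (P H) (v H) t a)%:R.

Definition orbit_total t l a : rat :=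
  \sum_H (w H)%:~R / #|H|%:R * (orbit_count S (P H) (v H) t l a)%:R.

Lemma fix_total_mark t a : t \in T ->
  #|S|%:R * fix_total t a = (\sum_(c in T | gam c == a) mark G w <[(t, c)]>)%:~R.
Proof.
move=> Tt; rewrite /mark exchange_big rmorph_sum mulr_sumr /=.
rewrite [RHS]big_mkcond /=; apply: eq_bigr => H _.
have [w0 | /sw hH] := eqVneq (w H) 0.
  by rewrite w0 !mul0r mulr0; case: ifP => // _; rewrite big1 // => c _; rewrite mul0r.
rewrite (fs_graph_sub hH) -mulr_sumr -natr_sum rmorphM /= mulrCA mulrA.
have nz : #|H|%:R != 0 :> rat by rewrite pnatr_eq0 -lt0n cardG_gt0.
rewrite -!mulrA; congr (_ * _); apply: (mulfI nz); rewrite mulVKf //.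
rewrite natz -pmulrn -!natrM; congr (_%:R).
by rewrite -(fix_count_mark _ (hf H) (Hf hH) (fs_graph_sub hH) Tt) mulnC.
Qed.

Lemma fix_total_stable t a chi : t \in T -> fs_hom F <[t]>%G S chi ->
  fix_total (chi t) a = fix_total t a.
Proof.
move=> Tt hchi.
have nz : #|S|%:R != 0 :> rat by rewrite pnatr_eq0 -lt0n cardG_gt0.
have Tt' : chi t \in T by apply: (fs_hyperfocal hchi) => //; apply: cycle_id.
apply: (mulfI nz); rewrite !fix_total_mark //; congr (_%:~R).
apply: eq_bigr => c /andP[Tc _]; apply: mark_cycle_stable hchi.
exact: subsetP sTS c Tc.
Qed.

Lemma fix_totalX t l a : t \in T -> (0 < l)%N ->
  fix_total (t ^+ l)%g a = orbit_total t l a +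
    \sum_(z : 'I_l.+1 * 'F_p | (z.1 %| l)%N && (z.2 *+ (l %/ z.1) == a)
       && (z.1 < l)%N) orbit_total t z.1 z.2.
Proof.
move=> Tt l_gt0; rewrite /fix_total.
have fixE H : fix_count S (P H) (v H) (t ^+ l)%g a = (orbit_count S (P H) (v H) t l a +
    \sum_(z : 'I_l.+1 * 'F_p | (z.1 %| l)%N && (z.2 *+ (l %/ z.1) == a)
       && (z.1 < l)%N) orbit_count S (P H) (v H) t z.1 z.2)%N.
  rewrite (fix_countX (T := T)) //; last first.
    by move=> y k Py Ty; rewrite /v /= (gam_fsX (hf H)).
  rewrite (bigD1 (ord_max, a)) /=; last by rewrite dvdnn divnn l_gt0 mulr1n eqxx.
  congr (_ + _)%N; apply: eq_bigl => -[[m ltm] b] /=.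
  case: (boolP (m %| l)%N) => //= dvm; case: eqP => //= ab.
  rewrite ltn_neqAle -[(m <= l)%N]ltnS ltm andbT; congr (~~ _).
  apply/eqP/eqP=> [[] // | eml]; congr (_, _); first exact: val_inj.
  by move: ab; rewrite eml divnn l_gt0 mulr1n.
under eq_bigr => H _ do rewrite fixE natrD mulrDr natr_sum mulr_sumr.
by rewrite big_split /= exchange_big.
Qed.

(** Induction on l: by [fix_totalX] the orbits of length l are a stable number of fixed points minus
    contributions of shorter orbits. *)
Lemma orbit_total_stable t l a chi : t \in T -> fs_hom F <[t]>%G S chi -> (0 < l)%N ->
  orbit_total (chi t) l a = orbit_total t l a.
Proof.
move=> Tt hchi; have [n] := ubnP l; elim: n l a => // n IHn l a lel l_gt0.
have Tt' : chi t \in T by apply: (fs_hyperfocal hchi) => //; apply: cycle_id.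
have hX : fs_hom F <[(t ^+ l)%g]>%G S chi.
  by apply: fs_res hchi _; rewrite cycleX.
have := fix_total_stable a (groupX l Tt) hX.
rewrite (fs_morphX _ hchi) ?cycle_id // !fix_totalX //.
rewrite (eq_bigr (fun z : 'I_l.+1 * 'F_p => orbit_total t z.1 z.2)); first exact: addIr.
move=> z /andP[/andP[dvz _] ltz]; apply: IHn; first exact: leq_trans ltz _.
exact: dvdn_gt0 dvz.
Qed.

Let X H t := transversal (rcosets (P H) S :* <[t]>)%g S.

Let trX H t : t \in S -> is_transversal (X H t) (rcosets (P H) S :* <[t]>)%g S.
Proof. by move=> St; apply: transversalP; apply: rcosets_cycle_partition. Qed.

(** The weighted sum of those terms in [fs_transfer] that involve f. *)
Definition fs_trace t : 'F_p :=
  \sum_H (w H)%:~R * \sum_(x in X H t)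
    v H ((t ^+ #|<[t]>%g : P H :* x|) ^ x^-1)%g.

Definition trace_mult t l a : int :=
  \sum_H w H * (orbit_num (P H) (v H) (X H t) t l a)%:R.

Lemma fs_traceE t : fs_trace t =
  \sum_(z : 'I_#|gT|.+1 * 'F_p) (trace_mult t z.1 z.2)%:~R * z.2.
Proof.
rewrite /fs_trace; under eq_bigr => H _ do rewrite sum_orbit_num mulr_sumr.
rewrite exchange_big /=; apply: eq_bigr => z _.
rewrite rmorph_sum mulr_suml /=; apply: eq_bigr => H _.
by rewrite rmorphM rmorph_nat /= mulrA.
Qed.

Lemma trace_mult0 t a : trace_mult t 0 a = 0.
Proof.
apply: big1 => H _; rewrite /orbit_num; have -> : [set x in X H t |
    (#|<[t]>%g : P H :* x| == 0%N) && (v H ((t ^+ 0) ^ x^-1)%g == a)] = set0.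
  apply/setP=> x; rewrite !inE index_rcoset_cycle.
  by rewrite [(_ == 0%N)](gtn_eqF (indexg_gt0 _ _)) andbF.
by rewrite cards0 mulr0.
Qed.

Lemma trace_mult_total t l a : t \in T ->
  orbit_total t l a = l%:R * (trace_mult t l a)%:~R.
Proof.
move=> Tt; rewrite /orbit_total rmorph_sum mulr_sumr /=; apply: eq_bigr => H _.
have [w0 | /sw hH] := eqVneq (w H) 0; first by rewrite w0 !mul0r mulr0.
rewrite (orbit_countE (sPS H) nTS sTS _ Tt (trX H (subsetP sTS t Tt))); last first.
  by move=> y b Py Ty Pb; rewrite /v /= (gam_fsJ (hf H)).
have nz : #|P H|%:R != 0 :> rat by rewrite pnatr_eq0 -lt0n cardG_gt0.
rewrite intrM [((_%:R)%:~R)]rmorph_nat (card_graph_dom hH) !natrM -!mulrA mulKf //.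
by rewrite mulrCA.
Qed.

Lemma fs_trace_stable t chi : t \in T -> fs_hom F <[t]>%G S chi ->
  fs_trace (chi t) = fs_trace t.
Proof.
move=> Tt hchi.
have Tt' : chi t \in T by apply: (fs_hyperfocal hchi) => //; apply: cycle_id.
rewrite !fs_traceE //; apply: eq_bigr => -[[[|l] ltl] a] _ /=.
  by rewrite !trace_mult0.
congr (_%:~R * _).
(* The length may be divisible by p, so it is cancelled in the rationals, before the multiplicities
   are reduced. *)
have nz : l.+1%:R != 0 :> rat by rewrite pnatr_eq0.
apply: (@intr_inj rat); apply: (mulfI nz).
by rewrite -!trace_mult_total // (orbit_total_stable _ Tt hchi).
Qed.

(** With y = x^-1 a(x), the element x^-1 a^k(x) is the product of the a^i(y) for i < k, so by
    stability its trace is k times that of y. For k the order of the p'-element a it is 0, and k is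
    invertible mod p. *)
Lemma fs_trace_eq0 t : {in T &, {morph fs_trace : x y / (x * y)%g >-> x + y}} ->
  t \in T -> fs_trace t = 0.
Proof.
move=> trM.
have tr1 : fs_trace 1%g = 0.
  by apply: (addrI (fs_trace 1%g)); rewrite -trM ?group1 // mulg1 addr0.
pose D := [set x in T | fs_trace x == 0].
have gD : group_set D.
  apply/group_setP; split=> [|x y]; first by rewrite inE group1 tr1 eqxx.
  case/setIdP=> Tx /eqP x0 /setIdP[Ty /eqP y0].
  by rewrite inE groupM // trM // x0 y0 addr0 eqxx.
suffices sTD : T \subset Group gD by move/(subsetP sTD)/setIdP=> [_ /eqP].
apply: hyperfocal_subG => Q a x sQS Aa p'a Qx.
have /Aut_fsP[AQa ha] := Aa.
set y := (x^-1 * a x)%g; have Ty : y \in T by apply: mem_hyperfocal Qx.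
have Qy : y \in Q by rewrite groupM ?groupV ?(fs_mem ha).
have AaX k : (a ^+ k)%g \in Aut_fs F Q.
  exact: (@groupX _ (Group (Aut_fs_group_set F sQS))).
have aXh k : fs_hom F Q Q (a ^+ k)%g by case/Aut_fsP: (AaX k).
have aXS k := fs_comp (aXh k) (fs_incl F sQS (subxx S)).
have tr_aX k : fs_trace ((a ^+ k)%g y) = fs_trace y.
  apply: (fs_trace_stable (chi := (a ^+ k)%g)) => //.
  by apply: fs_res (aXS k) _; rewrite cycle_subG.
have trk k : fs_trace (x^-1 * (a ^+ k)%g x)%g = fs_trace y *+ k.
  elim: k => [|k IHk]; first by rewrite expg0 perm1 mulVg tr1.
  have -> : (x^-1 * (a ^+ k.+1)%g x = (x^-1 * (a ^+ k)%g x) * (a ^+ k)%g y)%g.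
    rewrite /y (fs_morphM (aXh k)) ?groupV ?(fs_mem ha) // (fs_morphV (aXh k)) //.
    by rewrite mulgA mulgK expgS permM.
  rewrite trM ?IHk ?tr_aX ?mulrSr //; last first.
    exact: (fs_hyperfocal (aXS k)).
  by apply: (mem_hyperfocal sQS) => //; apply: p_eltX.
have := trk #[a]%g; rewrite expg_order perm1 mulVg tr1 => /esym/eqP.
rewrite -mulr_natl mulf_eq0 -(dvdn_pcharf (pchar_Fp p_pr)).
rewrite inE Ty => /orP[dvp|-> //].
by move: p'a; rewrite /p_elt p'natE // dvp.
Qed.

End Stable.

Local Open Scope ring_scope.

Lemma intr_Fp_eq0 (n : int) : (n%:~R == 0 :> 'F_p) = (p %| n)%Z.
Proof.
rewrite dvdzE (dvdn_pcharf (pchar_Fp p_pr)); case: n => n //.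
by rewrite NegzE mulrNz oppr_eq0.
Qed.

Lemma exists_additive_extension : exists2 lam : gT -> 'F_p,
  {in S &, {morph lam : x y / (x * y)%g >-> x + y}} & {in T, lam =1 gam}.
Proof.
have [w [sw stw degw]] := exists_characteristic pS satF p_pr.
have /fin_all_exists[Pf PfP] : forall H : {group gT * gT},
    exists Pf : {group gT} * {ffun gT -> gT}, fs_hom F Pf.1 S Pf.2 /\
      (fs_graph F H -> forall z, (z \in H) = (z.1 \in Pf.1) && (z.2 == Pf.2 z.1)).
  move=> H; have [/fs_graphP[P [f hf Hf]] | nH] := boolP (fs_graph F H).
    exists (P, [ffun x => f x]); rewrite /= fs_hom_ffun; split=> // _ z.
    by rewrite ffunE Hf.
  (* A placeholder: subgroups that are not graphs have weight 0. *)
  exists (1%G, [ffun x => x]); rewrite /= fs_hom_ffun; split=> //.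
  exact: fs_incl (sub1G S) (subxx S).
pose P H := (Pf H).1; pose f H : gT -> gT := (Pf H).2.
have hf H : fs_hom F (P H) S (f H) := (PfP H).1.
have Hf H (hH : fs_graph F H) : forall z, (z \in H) = (z.1 \in P H) && (z.2 == f H z.1).
  exact: (PfP H).2.
have sPS H : P H \subset S := (fs_obj (hf H)).1.
have /fin_all_exists[u uP] : forall H : {group gT * gT}, exists u : gT -> 'F_p,
    {in S &, {morph u : x y / (x * y)%g >-> x + y}} /\
    forall t X, t \in T -> is_transversal X (rcosets (P H) S :* <[t]>)%g S ->
      u t = \sum_(x in X) gam (f H ((t ^+ #|<[t]>%g : (P H) :* x|) ^ x^-1)%g)
             - gam t *+ #|S : P H|.
  by move=> H; have [u uM uE] := fs_transfer (hf H); exists u.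
pose U t := \sum_H (w H)%:~R * u H t : 'F_p.
pose N := \sum_H (w H)%:~R * (#|S : P H|)%:R : 'F_p.
have UM : {in S &, {morph U : x y / (x * y)%g >-> x + y}}.
  move=> x y Sx Sy; rewrite /U -big_split; apply: eq_bigr => H _.
  by rewrite (uP H).1 // mulrDr.
have UE t : t \in T -> U t = fs_trace w P f t - N * gam t.
  move=> Tt; rewrite /U /N mulr_suml -sumrB; apply: eq_bigr => H _.
  have St := subsetP sTS t Tt.
  rewrite ((uP H).2 t _ Tt (transversalP (rcosets_cycle_partition (sPS H) St))).
  by rewrite mulrBr -mulrA [_%:R * _]mulr_natl.
(* Its formula does not show additivity of the trace; it is inherited from U and [gam]. *)
have trM : {in T &, {morph fs_trace w P f : x y / (x * y)%g >-> x + y}}.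
  move=> x y Tx Ty; apply/eqP; rewrite -(subr_eq0 _ (_ + _)).
  have [Sx Sy] := (subsetP sTS x Tx, subsetP sTS y Ty).
  have := UM x y Sx Sy; rewrite !UE ?groupM // gamMl // => eqU.
  apply/eqP; move/eqP: eqU; rewrite -subr_eq0 => /eqP <-; ring.
have tr0 := fs_trace_eq0 sw stw hf Hf trM.
(* Mod p the index |S : P H| vanishes unless P H = S, so N reduces to the total weight of the top
   graphs. *)
have nzN : N != 0.
  have -> : N = (\sum_(H | top_graph F H) w H)%:~R.
    rewrite rmorph_sum /= [RHS]big_mkcond; apply: eq_bigr => H _.
    have [w0 | /sw hH] := eqVneq (w H) 0; first by rewrite w0 mul0r; case: ifP.
    rewrite /top_graph hH /= (card_graph_dom Hf hH).
    case: eqP => [oP | neP].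
      have -> : #|S : P H| = 1%N.
        by rewrite -divgS // oP divnn cardG_gt0.
      by rewrite mulr1.
    apply/eqP; rewrite mulf_eq0 -(dvdn_pcharf (pchar_Fp p_pr)); apply/orP; right.
    have : p.-nat #|S : P H| by apply: pnat_dvd pS; apply: dvdn_indexg.
    case/p_natP=> -[|k] oi; last by rewrite oi expnS dvdn_mulr.
    by case: neP; rewrite -(Lagrange (sPS H)) oi muln1.
  by rewrite intr_Fp_eq0.
exists (fun s => - (N^-1 * U s)) => [x y Sx Sy | t Tt].
  by rewrite UM // mulrDr opprD.
by rewrite UE // tr0 // sub0r mulrN opprK mulKf.
Qed.

End ExtendHyperfocal.

(** * Stable classes in degrees 1 and 2 *)

Section Cochains.

Variables (p : nat).

Lemma coset_coboundaries_eq (aT : finGroupType) n (c d : cochain p aT n) :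
  (coset (coboundaries p aT n) c = coset (coboundaries p aT n) d) <->
  (c - d)%R \in coboundaries p aT n.
Proof.
have nB (x : cochain p aT n) : x \in 'N(coboundaries p aT n).
  by rewrite (subsetP (sub_abelian_norm (cochain_abelian setT) _)) ?subsetT ?inE.
split=> [/rcoset_kercosetP | cd]; first by rewrite mem_rcoset; apply.
by apply/rcoset_kercosetP; rewrite ?nB // mem_rcoset.
Qed.

Section Subgroup.

Variables (gT : finGroupType) (S : {group gT}).
Implicit Types (gam : gT -> 'F_p) (z : gT -> gT -> 'F_p).

Definition cochain1 gam : cochain p (subg_of S) 1 :=
  [ffun g : subg_of S ^ 1 => gam (sgval (g ord0))].

Definition cochain2 z : cochain p (subg_of S) 2 :=
  [ffun g : subg_of S ^ 2 => z (sgval (g ord0)) (sgval (g ord_max))].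

Definition class1 gam := coset (coboundaries p (subg_of S) 1) (cochain1 gam).

Definition class2 z := coset (coboundaries p (subg_of S) 2) (cochain2 z).

Lemma cobound_cochain1 gam :
  cobound (cochain1 gam)
    = cochain2 (fun x y => gam x + gam y - gam (x * y)%g)%R.
Proof.
apply/ffunP=> g; rewrite !ffunE !big_ord_recr big_ord0 /= !ffunE /=.
have -> : lift ord0 ord0 = ord_max :> 'I_2 by apply: val_inj.
have -> : widen_ord (leqnSn 1) ord0 = ord0 by apply: val_inj.
ring.
Qed.

Lemma cochain1_onto (c : cochain p (subg_of S) 1) : exists gam, c = cochain1 gam.
Proof.
exists (fun x => c [ffun=> subg S x]); apply/ffunP=> g; rewrite ffunE.
by congr (c _); apply/ffunP=> i; rewrite ffunE sgvalK (ord1 i).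
Qed.

Lemma cobound_cochain2 z (g : subg_of S ^ 3) :
  let x := sgval (g ord0) in let y := sgval (g (inord 1)) in
  let w := sgval (g ord_max) in
  cobound (cochain2 z) g =
    (z y w - z (x * y)%g w + z x (y * w)%g - z x y)%R.
Proof.
rewrite !ffunE !big_ord_recr big_ord0 /= !ffunE /=.
have -> : lift ord0 ord0 = inord 1 :> 'I_3 by apply: val_inj; rewrite /= inordK.
have -> : lift ord0 ord_max = ord_max :> 'I_3 by apply: val_inj.
have -> : widen_ord (leqnSn 2) ord0 = ord0 by apply: val_inj.
have -> : widen_ord (leqnSn 2) ord_max = inord 1 by apply: val_inj; rewrite /= inordK.
ring.
Qed.

Lemma eq_cochain1 gam gam' : {in S, gam =1 gam'} <-> cochain1 gam = cochain1 gam'.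
Proof.
split=> [eqg | /ffunP eqg x Sx].
  by apply/ffunP=> g; rewrite !ffunE eqg ?subgP.
by have := eqg [ffun=> subg S x]; rewrite !ffunE subgK.
Qed.

(** Both faces of a 1-tuple are the empty tuple, and coefficients are trivial, so the two terms
    cancel. Classes in degree 1 are therefore just cochains. *)
Lemma coboundaries1_eq0 (c : cochain p (subg_of S) 1) :
  c \in coboundaries p (subg_of S) 1 -> c = 0%R.
Proof.
case/morphimP=> d _ _ ->; apply/ffunP=> g.
have dE i : d (face i g) = d [ffun=> 1] by congr (d _); apply/ffunP=> -[].
by rewrite !ffunE !big_ord_recr big_ord0 /= !dE expr0 expr1 mul1r mulN1r add0r subrr.
Qed.

Lemma class1_inj gam gam' : class1 gam = class1 gam' -> {in S, gam =1 gam'}.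
Proof.
move/coset_coboundaries_eq/coboundaries1_eq0/eqP; rewrite subr_eq0 => /eqP.
by move/eq_cochain1.
Qed.

Lemma mem_cohomology1 gam :
  {in S &, {morph gam : x y / (x * y)%g >-> (x + y)%R}} <->
  class1 gam \in cohomology p (subg_of S) 1.
Proof.
split=> [gM | ].
  apply: mem_quotient; apply/kerP; rewrite ?inE //= cobound_cochain1.
  apply/ffunP=> g; rewrite !ffunE gM ?subgP //; apply: subrr.
case/morphimP=> c _ Zc /coset_coboundaries_eq/coboundaries1_eq0/eqP.
rewrite subr_eq0 => /eqP eqc x y Sx Sy.
have Zg : cochain1 gam \in cocycles p (subg_of S) 1 by rewrite eqc.
move/kerP: Zg; rewrite inE => /(_ isT); rewrite /= cobound_cochain1 => /ffunP.
move/(_ [ffun i => if i == ord0 then subg S x else subg S y]).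
by rewrite !ffunE /= !subgK // => /eqP; rewrite subr_eq0 => /eqP.
Qed.

Lemma mem_cohomology2 z :
  (forall x y w, x \in S -> y \in S -> w \in S ->
     z y w - z (x * y)%g w + z x (y * w)%g - z x y = 0)%R ->
  class2 z \in cohomology p (subg_of S) 2.
Proof.
move=> zC; apply: mem_quotient; apply/kerP; rewrite ?inE //=.
by apply/ffunP=> g; rewrite cobound_cochain2 zC ?subgP // ffunE.
Qed.

Lemma eq_class2 z z' : class2 z = class2 z' <->
  exists gam, forall x y, x \in S -> y \in S ->
    (z x y - z' x y = gam x + gam y - gam (x * y)%g)%R.
Proof.
rewrite /class2 coset_coboundaries_eq; split=> [/morphimP[c _ _] | [gam zE]].
  have [gam ->] := cochain1_onto c; rewrite /= cobound_cochain1 => /ffunP zE.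
  exists gam => x y Sx Sy.
  have := zE [ffun i => if i == ord0 then subg S x else subg S y].
  by rewrite !ffunE /= !subgK.
apply/morphimP; exists (cochain1 gam); rewrite ?inE //= cobound_cochain1.
by apply/ffunP=> g; rewrite !ffunE -zE ?subgP.
Qed.

End Subgroup.

Section Pullback.

Variables (gT1 gT2 : finGroupType) (P : {group gT1}) (Q : {group gT2}) (f : gT1 -> gT2).
Hypotheses (fM : {in P &, {morph f : x y / x * y}}) (sfQ : forall x, x \in P -> f x \in Q).

Let fsM : {morph (fun x : subg_of P => subg Q (f (sgval x))) : x y / x * y}.
Proof.
by move=> x y; apply: val_inj; rewrite /= fM ?subgP // !subgK ?groupM ?sfQ ?subgP.
Qed.

Lemma subg_cohmap_class1 gam :
  subg_cohmap p P Q f 1 (class1 Q gam) = class1 P (gam \o f).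
Proof.
rewrite /subg_cohmap cohmapE //; congr coset; apply/ffunP=> g.
by rewrite !ffunE /= subgK // sfQ ?subgP.
Qed.

Lemma subg_cohmap_class2 z :
  subg_cohmap p P Q f 2 (class2 Q z) = class2 P (fun x y => z (f x) (f y)).
Proof.
rewrite /subg_cohmap cohmapE //; congr coset; apply/ffunP=> g.
by rewrite !ffunE /= !subgK // sfQ ?subgP.
Qed.

End Pullback.

Section Stable.

Variables (gT : finGroupType) (S : {group gT}) (F : fusion_system S).

Lemma fs_cohmap_class1 (P : {group gT}) f gam : fs_hom F P S f ->
  subg_cohmap p P S f 1 (class1 S gam) = class1 P (gam \o f).
Proof.
by move=> hf; apply: subg_cohmap_class1 (fs_morphM hf) _ _ => x; apply: fs_mem hf.
Qed.

Lemma fs_cohmap_class2 (P : {group gT}) f z : fs_hom F P S f ->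
  subg_cohmap p P S f 2 (class2 S z) = class2 P (fun x y => z (f x) (f y)).
Proof.
by move=> hf; apply: subg_cohmap_class2 (fs_morphM hf) _ _ => x; apply: fs_mem hf.
Qed.

Lemma mem_fs_cohomology1 gam : class1 S gam \in fs_cohomology p F 1 <->
  {in S &, {morph gam : x y / (x * y)%g >-> (x + y)%R}} /\
  (forall (P : {group gT}) f, fs_hom F P S f -> {in P, gam \o f =1 gam}).
Proof.
split=> [/setIdP[/mem_cohomology1 gM stg] | [gM stg]].
  split=> // P f hf x Px; move/forallP/(_ P)/forallP/(_ [ffun x => f x]): stg.
  have [sPS _] := fs_obj hf; rewrite fs_hom_ffun hf /= => /eqP.
  rewrite (fs_cohmap_class1 _ (fs_incl F sPS (subxx S))).
  rewrite (fs_cohmap_class1 (f := [ffun x => f x])) ?fs_hom_ffun //.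
  by move/class1_inj/(_ x Px) => /= ->; rewrite ffunE.
apply/setIdP; split; first exact/mem_cohomology1.
apply/forallP=> P; apply/forallP=> f; apply/implyP=> hf; have [sPS _] := fs_obj hf.
rewrite (fs_cohmap_class1 _ (fs_incl F sPS (subxx S))) (fs_cohmap_class1 _ hf).
by apply/eqP; congr coset; apply/eq_cochain1 => x Px; rewrite (stg P f hf x Px).
Qed.

Lemma mem_fs_cohomology2 z :
  (forall x y w, x \in S -> y \in S -> w \in S ->
     z y w - z (x * y)%g w + z x (y * w)%g - z x y = 0)%R ->
  (forall (P : {group gT}) f, fs_hom F P S f ->
     exists b, forall x y, x \in P -> y \in P ->
       (z x y - z (f x) (f y) = b x + b y - b (x * y)%g)%R) ->
  class2 S z \in fs_cohomology p F 2.
Proof.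
move=> zC stz; apply/setIdP; split; first exact: mem_cohomology2.
apply/forallP=> P; apply/forallP=> f; apply/implyP=> hf; have [sPS _] := fs_obj hf.
rewrite (fs_cohmap_class2 _ (fs_incl F sPS (subxx S))) (fs_cohmap_class2 _ hf).
by apply/eqP/eq_class2; apply: stz.
Qed.

End Stable.

End Cochains.

(** * Comparison of the quotients *)

Lemma exists_additive (p : nat) (gT : finGroupType) (K L : {group gT}) :
    prime p -> p.-group K -> L \proper K ->
  exists lam : gT -> 'F_p,
    [/\ {in K &, {morph lam : x y / x * y >-> (x + y)%R}},
        {in L, forall x, lam x = 0%R} & exists2 x, x \in K & lam x != 0%R].
Proof.
move=> p_pr pK /andP[sLK nsKL].
have [eqLK | [M maxM sLM]] := maximal_exists sLK.
  by case/negP: nsKL; rewrite -eqLK.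
have nMK := normal_norm (p_maximal_normal pK maxM).
have oQ : #|K / M| = p by rewrite card_quotient // (p_maximal_index pK maxM).
have /cyclicP[g defQ] : cyclic (K / M) by rewrite prime_cyclic ?oQ.
have og : #[g] = p by rewrite orderE -defQ.
pose lam x : 'F_p := if [pick i : 'I_p | coset M x == g ^+ i] is Some i
  then (i : nat)%:R%R else 0%R.
have lamE x i : coset M x = g ^+ i -> lam x = i%:R%R.
  rewrite /lam => xi; case: pickP => [j /eqP xj | /(_ (Ordinal (ltn_pmod i (prime_gt0 p_pr))))].
    apply/eqP; have /eqP := xj; rewrite xi eq_expg_mod_order og.
    by rewrite -(Fp_nat_mod p_pr i) => /eqP ->; rewrite (Fp_nat_mod p_pr).
  by rewrite /= xi -og expg_mod_order eqxx.
have lamK x : x \in K -> exists i, coset M x = g ^+ i.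
  move=> Kx; have /cycleP[i ->] : coset M x \in <[g]> by rewrite -defQ mem_quotient.
  by exists i.
exists lam; split=> [x y Kx Ky | x Lx |].
- have [[i xi] [j yj]] := (lamK x Kx, lamK y Ky).
  rewrite (lamE x i) // (lamE y j) // -natrD; apply: lamE.
  by rewrite morphM ?(subsetP nMK) //= xi yj expgD.
- by apply: (lamE x 0); rewrite coset_id // (subsetP sLM).
have /morphimP[x nx Kx gx] : g \in K / M by rewrite defQ cycle_id.
exists x => //; rewrite (lamE x 1%N); last by rewrite expg1.
exact: oner_neq0.
Qed.

Section InnerModInvariance.

Variables (p : nat) (gT : finGroupType) (S : {group gT}) (F : fusion_system S).
Hypotheses (pS : p.-group S) (satF : saturated F p).

Local Notation T := (hyperfocal_group p F).

Lemma additive1 (K : {group gT}) (lam : gT -> 'F_p) :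
  {in K &, {morph lam : x y / x * y >-> (x + y)%R}} -> lam 1 = 0%R.
Proof.
by move=> lM; apply: (addrI (lam 1)); rewrite -lM ?group1 // mulg1 addr0.
Qed.

Lemma additiveV (K : {group gT}) (lam : gT -> 'F_p) :
  {in K &, {morph lam : x y / x * y >-> (x + y)%R}} ->
  {in K, forall x, lam x^-1 = (- lam x)%R}.
Proof.
move=> lM x Kx; apply/eqP; rewrite -addr_eq0 -lM ?groupV // mulVg.
by rewrite (additive1 lM).
Qed.

Lemma additiveJ (K : {group gT}) (lam : gT -> 'F_p) :
  {in K &, {morph lam : x y / x * y >-> (x + y)%R}} ->
  {in K &, forall x y, lam (x ^ y) = lam x}.
Proof.
move=> lM x y Kx Ky; rewrite conjgE !lM ?groupM ?groupV // (additiveV lM) //.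
by rewrite addrC addrK.
Qed.

(** A stable homomorphism agrees at x and a(x), so it kills the generators of h. Conversely, a
    morphism alters x only by a conjugation and an element of h. *)
Lemma stable_class1 (lam : gT -> 'F_p) : class1 S lam \in fs_cohomology p F 1 <->
  {in S &, {morph lam : x y / x * y >-> (x + y)%R}} /\
  {in T, forall x, lam x = 0%R}.
Proof.
rewrite mem_fs_cohomology1; split=> -[lM lT]; split=> //.
  pose D := [set x in S | lam x == 0%R].
  have gD : group_set D.
    apply/group_setP; split=> [|x y]; first by rewrite inE group1 (additive1 lM) eqxx.
    case/setIdP=> Sx /eqP x0 /setIdP[Sy /eqP y0].
    by rewrite inE groupM // lM // x0 y0 addr0 eqxx.
  suffices sTD : T \subset Group gD by move=> x /(subsetP sTD)/setIdP[_ /eqP].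
  apply: hyperfocal_subG => P a x sPS /Aut_fsP[AP ha] _ Px.
  have Sx := subsetP sPS x Px; have Sax := subsetP sPS _ (fs_mem ha Px).
  rewrite inE groupM ?groupV // lM ?groupV // (additiveV lM) //.
  have := lT P a (fs_comp ha (fs_incl F sPS (subxx S))) x Px.
  by rewrite /= => ->; rewrite addNr.
move=> P f hf x Px; have [s Ss fE] := fs_inner_mod pS satF hf.
have [sPS _] := fs_obj hf; have Sx := subsetP sPS x Px; have Sfx := fs_mem hf Px.
have nS := subsetP (hyperfocal_norm p F).
have /rcoset_kercosetP := fE x Px; rewrite !nS ?groupJ // => /(_ isT isT).
rewrite mem_rcoset => /lT; rewrite lM ?groupV ?groupJ // (additiveV lM) ?groupJ //.
by rewrite (additiveJ lM) // => /eqP; rewrite subr_eq0 => /eqP.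
Qed.

(* Conjugation by [s] acts trivially on the cohomology of the quotient: if
   [z x y = gam x + gam y - gam (x * y)] formally, then
   [gam (x ^ s) - gam x = z s (x ^ s) - z x s]. *)
Lemma inflation_stable (z : gT -> gT -> 'F_p) :
    (forall x y w, x \in S -> y \in S -> w \in S ->
     z y w - z (x * y)%g w + z x (y * w)%g - z x y = 0)%R ->
    (forall x x' y y', x \in S -> x' \in S -> y \in S -> y' \in S ->
      coset T x = coset T x' -> coset T y = coset T y' -> z x y = z x' y') ->
  class2 S z \in fs_cohomology p F 2.
Proof.
move=> zC zT; apply: mem_fs_cohomology2 => // P f hf.
have [s Ss fE] := fs_inner_mod pS satF hf; have [sPS _] := fs_obj hf.
exists (fun x => z x s - z s (x ^ s)%g)%R => x y Px Py.
have [Sx Sy] := (subsetP sPS x Px, subsetP sPS y Py).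
rewrite (zT (f x) (x ^ s) (f y) (y ^ s)) ?(fs_mem hf) ?groupJ ?fE //.
(* Three cocycle identities move s across x and then y; by s x^s = x s their alternating sum is the
   claim. *)
have z1 := zC s (x ^ s) (y ^ s) Ss (groupJ Sx Ss) (groupJ Sy Ss).
have z2 := zC x s (y ^ s) Sx Ss (groupJ Sy Ss).
have z3 := zC x y s Sx Sy Ss.
rewrite -!conjgC -conjMg in z1; rewrite -conjgC in z2.
apply/eqP; rewrite -subr_eq0; apply/eqP.
have comb (a b c d : 'F_p) : a = 0%R -> b = 0%R -> c = 0%R -> d = (b - a - c)%R -> d = 0%R.
  by move=> -> -> -> ->; rewrite !subr0.
apply: (comb _ _ _ _ z1 z2 z3); ring.
Qed.

End InnerModInvariance.

(** A p'-automorphism a of P yields b on phi(P) with b phi = phi a, again of order prime to p; so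
    phi sends each x^-1 a(x) to an element of the same form. *)
Lemma hyperfocal_fusion_preserving (p : nat) (gT1 gT2 : finGroupType)
    (S1 : {group gT1}) (S2 : {group gT2})
    (F1 : fusion_system S1) (F2 : fusion_system S2)
    (phi : {morphism S1 >-> gT2}) :
  fusion_preserving F1 F2 phi ->
  hyperfocal p F1 \subset phi @*^-1 (hyperfocal p F2).
Proof.
move=> fp.
apply: (hyperfocal_subG (D := phi @*^-1 (hyperfocal_group p F2))%G) => P a x sPS Aa p'a Px.
have /Aut_fsP[AP ha] := Aa; have Pax := fs_mem ha Px.
have [Sx Sax] := (subsetP sPS x Px, subsetP sPS _ Pax).
rewrite /= mem_morphpre ?groupM ?groupV // morphM ?groupV // morphV //.
have [b hb bE] := fp P a (fs_comp ha (fs_incl F1 sPS (subxx S1))).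
have [sphiP _] := fs_obj hb.
have defphi : phi @* P = phi @: P by rewrite morphimEsub.
have hb' : fs_hom F2 (phi @* P)%G (phi @* P)%G b.
  apply: fs_corestr hb _ sphiP; apply/subsetP=> _ /imsetP[_ /= /[!defphi]/imsetP[y Py ->] ->].
  by rewrite -bE // imset_f // (fs_mem ha).
have [b' Ab' b'E] := Aut_fs_of_hom hb'.
have phiP y : y \in P -> phi y \in phi @* P by move=> Py; rewrite defphi imset_f.
rewrite bE // -b'E ?phiP //; apply: mem_hyperfocal (phiP x Px) => //.
have /Aut_fsP[APb _] := Ab'.
apply: (p'elt_intertwine (f := phi)) AP APb defphi _ p'a => y Py.
by rewrite b'E ?phiP // bE.
Qed.

(** * Stallings' argument *)

Section Comparison.

Variables (p : nat) (gT1 gT2 : finGroupType) (S1 : {group gT1}) (S2 : {group gT2}).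
Variables (F1 : fusion_system S1) (F2 : fusion_system S2) (phi : {morphism S1 >-> gT2}).
Hypotheses (p_pr : prime p) (pS1 : p.-group S1) (pS2 : p.-group S2).
Hypotheses (satF1 : saturated F1 p) (satF2 : saturated F2 p).
Hypotheses (sphiS : phi @* S1 \subset S2) (phi_fp : fusion_preserving F1 F2 phi).

Local Notation h1 := (hyperfocal_group p F1).
Local Notation h2 := (hyperfocal_group p F2).

Let phiM : {in S1 &, {morph phi : x y / x * y}}.
Proof. exact: morphM. Qed.

Let phiS x : x \in S1 -> phi x \in S2.
Proof. by move=> Sx; rewrite (subsetP sphiS) // mem_morphim. Qed.

Hypothesis inj1 : {in fs_cohomology p F2 1 &, injective (subg_cohmap p S1 S2 phi 1)}.
Hypothesis onto1 :
  subg_cohmap p S1 S2 phi 1 @: fs_cohomology p F2 1 = fs_cohomology p F1 1.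
Hypothesis inj2 : {in fs_cohomology p F2 2 &, injective (subg_cohmap p S1 S2 phi 2)}.

Lemma phi_onto_mod_hyperfocal : phi @* S1 <*> h2 = S2.
Proof.
have sMS : phi @* S1 <*> h2 \subset S2 by rewrite join_subG sphiS hyperfocal_sub.
apply/eqP; rewrite eqEsubset sMS /=; apply/negPn/negP=> nsSM.
have prM : (phi @* S1 <*> h2)%G \proper S2 by rewrite /proper sMS.
have [lam [lamM lam0 [x Sx nzx]]] := exists_additive p_pr pS2 prM.
case/eqP: nzx; apply: (class1_inj (S := S2) (gam' := fun _ => 0%R)) Sx.
apply: inj1.
- apply/(stable_class1 pS2 satF2); split=> // y hy; apply: lam0.
  by rewrite mem_gen // inE hy orbT.
- by apply/(stable_class1 pS2 satF2); split=> // y w _ _; rewrite addr0.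
rewrite !subg_cohmap_class1 //; congr coset; apply/eq_cochain1 => y Sy /=.
by apply: lam0; rewrite mem_gen // inE mem_morphim.
Qed.

Let K : {group gT1} := (phi @*^-1 h2)%G.

Let KP x : x \in S1 -> (x \in K) = (phi x \in h2).
Proof. by move=> Sx; rewrite /= morphpreE inE Sx inE. Qed.

Let sKS : K \subset S1. Proof. exact: subsetIl. Qed.

Let phi_lift a : a \in S2 -> exists2 x, x \in S1 & coset h2 (phi x) = coset h2 a.
Proof.
rewrite -{1}phi_onto_mod_hyperfocal norm_joinEl; last first.
  exact: subset_trans sphiS (hyperfocal_norm p F2).
case/mulsgP=> _ t /morphimP[x _ Sx ->] ht ->; exists x => //.
exact/esym/coset_kerr.
Qed.

Let eq_coset x y : x \in S1 -> y \in S1 ->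
  (coset h2 (phi x) = coset h2 (phi y)) <-> (x^-1 * y \in K).
Proof.
move=> Sx Sy; have n2 := subsetP (hyperfocal_norm p F2).
have [nx ny] := (n2 _ (phiS Sx), n2 _ (phiS Sy)).
rewrite KP ?groupM ?groupV // morphM ?groupV // morphV //.
split=> [eqxy | hxy].
  apply: coset_idr; first by rewrite groupM ?groupV.
  by rewrite morphM ?groupV // morphV //= eqxy mulVg.
by rewrite -[phi y](mulKVg (phi x)) coset_kerr.
Qed.

Lemma hyperfocal_preim : K = h1.
Proof.
have sh1K : h1 \subset K by apply: hyperfocal_fusion_preserving phi_fp.
apply/eqP; rewrite eq_sym -val_eqE eqEsubset sh1K /=; apply/negPn/negP=> nsKh.
have nKS : S1 \subset 'N(K).
  apply/subsetP=> s Ss; rewrite inE; apply/subsetP=> _ /imsetP[k Kk ->].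
  have Sk := subsetP sKS k Kk; move: Kk; rewrite !KP ?groupJ // morphJ //.
  by rewrite memJ_norm // (subsetP (hyperfocal_norm p F2)) ?phiS.
(* K/L is the largest quotient of K/h1 on which S1 acts trivially; it is nontrivial because S1/h1 is
   nilpotent. *)
pose L := ([~: K, S1] <*> h1)%G.
have sLK : L \subset K by rewrite join_subG commg_subl nKS.
have prL : L \proper K.
  rewrite /proper sLK; apply: contra nsKh => sKL.
  have nhS : S1 \subset 'N(h1) := hyperfocal_norm p F1.
  have nhK := subset_trans sKS nhS.
  rewrite -quotient_sub1 //; apply/negPn/negP; rewrite subG1 => ntK.
  have nilQ : nilpotent (S1 / h1) by exact: pgroup_nil (quotient_pgroup h1 pS1).
  have sNK : S1 / h1 \subset 'N_(S1 / h1)(K / h1).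
    by rewrite subsetI subxx quotient_norms.
  have := nil_comm_properl nilQ (quotientS h1 sKS) ntK sNK.
  rewrite properE -quotientR // => /andP[_ /negP[]].
  rewrite -(quotientYidr (subset_trans _ nhS)); first exact: quotientS.
  by apply: subset_trans sKS; rewrite commg_subl.
have [f [fM fL [k0 Kk0 nzk0]]] := exists_additive p_pr (pgroupS sKS pS1) prL.
have fJ k s : k \in K -> s \in S1 -> f (k ^ s) = f k.
  move=> Kk Ss; have Kks : k ^ s \in K by rewrite memJ_norm // (subsetP nKS).
  have -> : k ^ s = k * [~ k, s] by rewrite commgEl mulKVg.
  have Lks : [~ k, s] \in L by rewrite mem_gen // inE mem_commg.
  by rewrite fM ?(subsetP sLK _ Lks) // (fL _ Lks) addr0.
(* Transgression: f is extended along coset representatives of K, and by its invariance the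
   coboundary [z1] of the extension depends only on classes mod K. *)
pose g1 x := f ((repr (x *: K))^-1 * x).
have g1K x k : k \in K -> g1 (x * k) = (g1 x + f k)%R.
  move=> Kk; rewrite /g1 lcosetM [k *: K]lcoset_id // mulgA fM //.
  have : repr (x *: K) \in x *: K by apply: mem_repr (lcoset_refl _ _).
  by case/lcosetP=> k' Kk' ->; rewrite invMg mulgKV groupV.
pose z1 x y := (g1 x + g1 y - g1 (x * y)%g)%R.
have z1K x y k l : x \in S1 -> y \in S1 -> k \in K -> l \in K ->
    z1 (x * k) (y * l) = z1 x y.
  move=> Sx Sy Kk Kl; rewrite /z1.
  have -> : x * k * (y * l) = (x * y) * (k ^ y * l) by rewrite conjgE !mulgA mulgK.
  have Kky : k ^ y \in K by rewrite memJ_norm // (subsetP nKS).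
  by rewrite (g1K x k Kk) (g1K y l Kl) (g1K (x * y) _ (groupM Kky Kl)) fM // fJ //; ring.
have /fin_all_exists[sg sgP] : forall a : gT2, exists x : gT1, a \in S2 ->
    x \in S1 /\ coset h2 (phi x) = coset h2 a.
  move=> a; have [Sa | _] := boolP (a \in S2); last by exists 1.
  by have [u Su ua] := phi_lift Sa; exists u.
(* As [phi] is onto mod h2, lifting carries [z1] to a cocycle inflated from S2/h2, whose pullback
   along [phi] is [z1]. *)
pose z2 a b := z1 (sg a) (sg b).
have z1_mod x x' y y' : x \in S1 -> x' \in S1 -> y \in S1 -> y' \in S1 ->
    coset h2 (phi x) = coset h2 (phi x') -> coset h2 (phi y) = coset h2 (phi y') ->
    z1 x y = z1 x' y'.
  move=> Sx Sx' Sy Sy' /(eq_coset Sx Sx') Kx /(eq_coset Sy Sy') Ky.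
  by rewrite -(mulKVg x x') -(mulKVg y y') z1K.
have z2_mod a a' b b' : a \in S2 -> a' \in S2 -> b \in S2 -> b' \in S2 ->
    coset h2 a = coset h2 a' -> coset h2 b = coset h2 b' -> z2 a b = z2 a' b'.
  move=> Sa Sa' Sb Sb' eqa eqb; have [[Sx xa] [Sx' xa']] := (sgP a Sa, sgP a' Sa').
  have [[Sy yb] [Sy' yb']] := (sgP b Sb, sgP b' Sb').
  by apply: z1_mod; rewrite // ?xa ?yb ?eqa ?eqb.
have z2phi x y : x \in S1 -> y \in S1 -> z2 (phi x) (phi y) = z1 x y.
  move=> Sx Sy; have [[Sx' xE] [Sy' yE]] := (sgP _ (phiS Sx), sgP _ (phiS Sy)).
  exact: z1_mod.
have n2 := subsetP (hyperfocal_norm p F2).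
have sgM a b : a \in S2 -> b \in S2 ->
    coset h2 (phi (sg (a * b))) = coset h2 (phi (sg a * sg b)).
  move=> Sa Sb; have [[Sx xa] [Sy yb]] := (sgP a Sa, sgP b Sb).
  have [_ ->] := sgP (a * b) (groupM Sa Sb).
  by rewrite (morphM phi) // !morphM ?n2 ?phiS //= xa yb.
have z2C a b c : a \in S2 -> b \in S2 -> c \in S2 ->
    (z2 b c - z2 (a * b)%g c + z2 a (b * c)%g - z2 a b = 0)%R.
  move=> Sa Sb Sc; rewrite /z2.
  have [[[Sx _] [Sy _]] [Sw _]] := (sgP a Sa, sgP b Sb, sgP c Sc).
  have [[Sxy _] [Syw _]] := (sgP _ (groupM Sa Sb), sgP _ (groupM Sb Sc)).
  rewrite (z1_mod (sg (a * b)) (sg a * sg b) (sg c) (sg c)) ?groupM ?sgM //.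
  rewrite (z1_mod (sg a) (sg a) (sg (b * c)) (sg b * sg c)) ?groupM ?sgM //.
  rewrite /z1 !mulgA; ring.
have z2st : class2 S2 z2 \in fs_cohomology p F2 2 by apply: inflation_stable.
have zero_st : class2 S2 (fun _ _ => 0%R) \in fs_cohomology p F2 2.
  by apply: inflation_stable => // *; rewrite !(subr0, addr0).
have [g2 g2E] : exists g2, forall x y, x \in S2 -> y \in S2 ->
    (z2 x y - 0 = g2 x + g2 y - g2 (x * y)%g)%R.
  apply/eq_class2/inj2 => //; rewrite !subg_cohmap_class2 //.
  by apply/eq_class2; exists g1 => x y Sx Sy; rewrite subr0 z2phi.
(* The shift makes [gam] vanish at 1, and lowers the coboundary by the constant e. *)
pose e := g2 1; pose gam x := (g2 x - e)%R.
have gamE x y : x \in S2 -> y \in S2 ->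
    (gam x + gam y - gam (x * y)%g = z2 x y - e)%R.
  by move=> Sx Sy; rewrite -[z2 x y]subr0 g2E // /gam; ring.
have gam1 : gam 1 = 0%R by rewrite /gam subrr.
have gam_mod x x' y y' : x \in S2 -> x' \in S2 -> y \in S2 -> y' \in S2 ->
    coset h2 x = coset h2 x' -> coset h2 y = coset h2 y' ->
    (gam x + gam y - gam (x * y)%g = gam x' + gam y' - gam (x' * y')%g)%R.
  by move=> *; rewrite !gamE //; congr (_ - _)%R; apply: z2_mod.
have [lam lamM lamE] := exists_additive_extension p_pr pS2 satF2 gam1 gam_mod.
(* [gam - lam] vanishes on h2 and has the coboundary [z2 - e] of [gam]. Subtracting its pullback and
   the constant e from [g1] leaves a homomorphism that still extends f. *)
pose mu x := (g1 x - (gam (phi x) - lam (phi x)) - e)%R.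
have muM : {in S1 &, {morph mu : x y / x * y >-> (x + y)%R}}.
  move=> x y Sx Sy; rewrite /mu morphM // lamM ?phiS //.
  have := gamE _ _ (phiS Sx) (phiS Sy); rewrite z2phi // => eqz.
  have {}eqz : z1 x y = (gam (phi x) + gam (phi y) - gam (phi x * phi y)%g + e)%R.
    by rewrite eqz subrK.
  by rewrite -[g1 (x * y)](subKr (g1 x + g1 y)%R) -/(z1 x y) eqz; ring.
have muK k : k \in K -> mu k = f k.
  move=> Kk; have Sk := subsetP sKS k Kk.
  have hk : phi k \in h2 by rewrite -KP.
  have := additive1 muM; rewrite /mu morph1 lamE ?group1 // subrr subr0 => /eqP.
  rewrite subr_eq0 => /eqP g11; rewrite lamE // subrr subr0.
  by rewrite -{1}[k]mul1g g1K // g11 addrAC subrr add0r.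
have : class1 S1 mu \in fs_cohomology p F1 1.
  apply/(stable_class1 pS1 satF1); split=> // x hx.
  rewrite muK ?(subsetP sh1K) // fL // mem_gen // inE hx orbT //.
rewrite -onto1 => /imsetP[c c_st].
have [nu defc] : exists nu, c = class1 S2 nu.
  case/setIdP: c_st => /morphimP[d _ _ ->] _.
  by have [nu ->] := cochain1_onto d; exists nu.
rewrite {}defc in c_st *; rewrite subg_cohmap_class1 // => /class1_inj muE.
have [_ nu0] := (stable_class1 pS2 satF2 nu).1 c_st.
case/eqP: nzk0; rewrite -muK // muE ?(subsetP sKS) //=; apply: nu0.
by rewrite -KP // (subsetP sKS).
Qed.

Lemma quotient_hyperfocal_isog : S1 / h1 \isog S2 / h2.
Proof.
pose psi x := coset h2 (phi x).
have psiM : {in S1 &, {morph psi : x y / x * y}}.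
  move=> x y Sx Sy; rewrite /psi morphM //.
  by rewrite (morphM (coset_morphism h2)) // (subsetP (hyperfocal_norm p F2)) ?phiS.
pose Psi := Morphism psiM.
have kerPsi : 'ker Psi = h1.
  rewrite -hyperfocal_preim; apply/setP=> x.
  have [Sx | nSx] := boolP (x \in S1); last by rewrite !inE (negbTE nSx).
  rewrite (KP Sx); apply/(kerP Psi Sx)/idP => [/= px1 | hx]; last exact: coset_id.
  by apply: coset_idr px1; rewrite (subsetP (hyperfocal_norm p F2)) ?phiS.
have imPsi : Psi @* S1 = S2 / h2.
  apply/setP=> y; apply/morphimP/morphimP=> [[x _ Sx ->] | [b _ Sb ->]].
    by exists (phi x); rewrite ?(subsetP (hyperfocal_norm p F2)) ?phiS.
  by have [x Sx xb] := phi_lift Sb; exists x.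
by rewrite -imPsi -kerPsi; apply: first_isog.
Qed.

End Comparison.

Theorem theorem1p2 (p : nat) (gT1 gT2 : finGroupType)
    (S1 : {group gT1}) (S2 : {group gT2})
    (F1 : fusion_system S1) (F2 : fusion_system S2)
    (phi : {morphism S1 >-> gT2}) :
  prime p -> p.-group S1 -> p.-group S2 ->
  saturated F1 p -> saturated F2 p ->
  phi @* S1 \subset S2 ->
  fusion_preserving F1 F2 phi ->
  {in fs_cohomology p F2 1 &, injective (subg_cohmap p S1 S2 phi 1)} ->
  subg_cohmap p S1 S2 phi 1 @: fs_cohomology p F2 1 = fs_cohomology p F1 1 ->
  {in fs_cohomology p F2 2 &, injective (subg_cohmap p S1 S2 phi 2)} ->
  (S1 / hyperfocal p F1) \isog (S2 / hyperfocal p F2).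
Proof. exact: quotient_hyperfocal_isog. Qed.
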